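(* Let $K\ge2$ and $\epsilon>0$. Consider a $K$-armed Bernoulli bandit with mean rewards $\mu_1,\dots,\mu_K$, arm $1$ being the optimal arm ($\mu_1>\mu_a$ for $a\ge2$), $\Delta_a=\mu_1-\mu_a$, whose feedback is produced by the $\epsilon$-locally differentially private randomized response scheme which, for every arm, returns a feedback equal to the binary reward with probability $\frac{e^\epsilon}{1+e^\epsilon}$ and equal to the flipped reward with probability $\frac{1}{1+e^\epsilon}$. Then, for each of the algorithms kl-UCB-CF (with $f(t)=\log t+3\log\log t$) and TS-CF, run with the corresponding corruption functions, as $T\to\infty$, $$\mathrm{Regret}_T \;\leq\; \sum_{a = 2}^{K}\frac{2\log(T)}{ \Delta_a \left( \frac{e^\epsilon - 1}{e^\epsilon + 1}\right)^2} + O\big(\sqrt{\log(T)}\big),$$ where the constant in $O(\cdot)$ may depend on the bandit instance and on $\epsilon$.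
   Context: **Setting.** Arms $A=\{1,\dots,K\}$. At each time $t$ the learner selects an arm $\hat a_t$ based only on past observed feedbacks (and internal randomization). If $\hat a_t=a$, a reward $R_t\sim\mathrm{Bernoulli}(\mu_a)$ is generated but not observed; the learner observes a feedback $F_t\in\{0,1\}$ with $\mathbb P(F_t=R_t\mid R_t)=\frac{e^\epsilon}{1+e^\epsilon}$, the randomness being independent across rounds. Thus $F_t\sim\mathrm{Bernoulli}(\lambda_a)$ with $\lambda_a=g_a(\mu_a)$, where the corruption function is $$g_a(x)=\frac{1}{1+e^\epsilon}+\frac{e^\epsilon-1}{e^\epsilon+1}\,x,\qquad x\in\mathbb R .$$ Local differential privacy with parameter $\epsilon$ means that for any two reward values $x,x'$ and any feedback value $y$, $\mathbb P(F=y\mid R=x)\le e^\epsilon\,\mathbb P(F=y\mid R=x')$. $N_a(t)$ is the number of selections of arm $a$ up to time $t$, and $\mathrm{Regret}_T=\mathbb E[\mu_1T-\sum_{t=1}^TR_t]=\sum_{a=2}^K\Delta_a\mathbb E[N_a(T)]$. **Divergence.** $d(x,y)=x\log(x/y)+(1-x)\log((1-x)/(1-y))$ for $x,y\in[0,1]$, with usual conventions. **Algorithm kl-UCB-CF.** First pull each arm once (times $1,\dots,K$). Then for $t=K,\dots,T-1$: compute $\mathrm{Index}_a(t)=\max\{q:\ g_a(q)\in[0,1],\ N_a(t)\,d(\hat\lambda_a(t),g_a(q))\le f(t)\}$ with $\hat\lambda_a(t)=\frac1{N_a(t)}\sum_{s=1}^tF_s\mathbf 1_{(\hat a_s=a)}$;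 pull $\hat a_{t+1}\in\arg\max_a\mathrm{Index}_a(t)$ (ties arbitrary) and observe $F_{t+1}$. Here $f(t)=\log t+3\log\log t$ for $t\ge3$; for $t<3$, $f(t)$ is any nonnegative value keeping $f$ non-decreasing. **Algorithm TS-CF.** Keep counters $\mathrm{success}_a=\mathrm{fail}_a=0$ initially. For $t=0,1,\dots,T-1$: for each arm sample, independently given the past, $\theta_a(t)\sim\mathrm{Beta}(\mathrm{success}_a+1,\mathrm{fail}_a+1)$; pull $\hat a_{t+1}\in\arg\max_a g_a^{-1}(\theta_a(t))$, observe $F_{t+1}$; if $F_{t+1}=1$ increment $\mathrm{success}_{\hat a_{t+1}}$, otherwise increment $\mathrm{fail}_{\hat a_{t+1}}$. *)

(* Defs.v *)
From HB Require Import structures.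
From mathcomp Require Export all_boot all_order all_algebra.
From mathcomp Require Export all_classical all_reals all_analysis.
From mathcomp Require Import ring lra.

Set Implicit Arguments.
Unset Strict Implicit.
Unset Printing Implicit Defensive.

Import Order.TTheory GRing.Theory Num.Theory.
Export numFieldNormedType.Exports.

Local Open Scope classical_set_scope.
Local Open Scope ring_scope.

Section randomized_response.
Context {R : realType}.
Implicit Types (eps x y : R) (r f : bool).

(* P(F = f | R = r). *)
Definition rand_resp eps r f : R :=
  if f == r then expR eps / (1 + expR eps) else (1 + expR eps)^-1.

Definition corrupt eps x : R :=
  (1 + expR eps)^-1 + (expR eps - 1) / (expR eps + 1) * x.

Definition corrupt_inv eps y : R :=
  (y - (1 + expR eps)^-1) / ((expR eps - 1) / (expR eps + 1)).

Lemma corruptK eps : 0 < eps -> cancel (corrupt eps) (corrupt_inv eps).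
Proof.
move=> eps0 x; have e1 : 1 < expR eps by rewrite expR_gt1.
by rewrite /corrupt_inv /corrupt; field; rewrite ?gt_eqF //; lra.
Qed.

Lemma corrupt_invK eps : 0 < eps -> cancel (corrupt_inv eps) (corrupt eps).
Proof.
move=> eps0 y; have e1 : 1 < expR eps by rewrite expR_gt1.
by rewrite /corrupt_inv /corrupt; field; rewrite ?gt_eqF //; lra.
Qed.

Lemma rand_resp_corrupt eps x :
  x * rand_resp eps true true + (1 - x) * rand_resp eps false true =
  corrupt eps x.
Proof.
have e0 : 0 < expR eps := expR_gt0 eps.
by rewrite /rand_resp /corrupt /=; field; rewrite gt_eqF //; lra.
Qed.

Lemma rand_resp_ldp eps r r' f :
  0 <= eps -> rand_resp eps r f <= expR eps * rand_resp eps r' f.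
Proof.
move=> eps0; have e1 : 1 <= expR eps by rewrite -expR0 ler_expR.
have D0 : 0 < 1 + expR eps by lra.
have V0 : 0 <= (1 + expR eps)^-1 by rewrite invr_ge0 ltW.
have V1 : (1 + expR eps)^-1 <= expR eps * (1 + expR eps)^-1.
  by rewrite ler_peMl.
rewrite /rand_resp; case: (f == r); case: (f == r') => //.
- by rewrite ler_peMl // mulr_ge0 // expR_ge0.
- by rewrite (le_trans V1) // ler_peMl // mulr_ge0 // expR_ge0.
Qed.

End randomized_response.

Section kl.
Context {R : realType}.

(* [ln] and [/] are total with [ln 0 = 0] and [x / 0 = 0], so the conventions
   0 log (0 / y) = 0 and x log (x / 0) = +oo have to be spelled out. *)
Definition kl_term (x y : R) : \bar R :=
  if x == 0 then 0%E
  else if y == 0 then +oo%E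
  else (x * ln (x / y))%:E.

Definition kl (x y : R) : \bar R := (kl_term x y + kl_term (1 - x) (1 - y))%E.

End kl.

(* An observed history lists, in chronological order, the pairs (pulled arm,
   observed feedback); rounds are numbered from 0, so that the history
   available in round [t] has size [t]. *)

Section algorithms.
Context {R : realType} {K : nat}.
Implicit Types (eps : R) (o : seq ('I_K * bool)) (a : 'I_K).

Definition npull o a : nat := count (fun x => x.1 == a) o.
Definition nsuccess o a : nat := count (pred1 (a, true)) o.
Definition nfail o a : nat := count (pred1 (a, false)) o.

Definition emp_mean o a : R := (nsuccess o a)%:R / (npull o a)%:R.

(* The values at 0, 1 and 2 are left free. *)
Definition klucb_exploration (f : nat -> R) : Prop :=
  [/\ forall t, (3 <= t)%N -> f t = ln t%:R + 3 * ln (ln t%:R),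
      forall t, 0 <= f t &
      {homo f : s t / (s <= t)%N >-> s <= t}].

(* If [eps] and [npull o a] are positive and [0 <= f (size o)], the set is nonempty and
   compact, so that its supremum is a maximum. *)
Definition klucb_index eps (f : nat -> R) o a : R :=
  sup [set q | 0 <= corrupt eps q <= 1 /\
    ((npull o a)%:R%:E * kl (emp_mean o a) (corrupt eps q)
       <= (f (size o))%:E)%E].

(* The rule is a relation: ties, and the order of the initial pulls, are
   arbitrary. *)
Definition klucb_rule eps (f : nat -> R) o a : Prop :=
  if (size o < K)%N then npull o a = 0%N
  else forall b, klucb_index eps f o b <= klucb_index eps f o a.

Definition ts_rule eps (th : 'I_K -> R) a : Prop :=
  forall b, corrupt_inv eps (th b) <= corrupt_inv eps (th a).

End algorithms.

Section runs.
Context {R : realType} {K : nat} {d : measure_display} {Omega : measurableType d}.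
Variable P : probability Omega R.
Implicit Types (eps : R) (mu : 'I_K -> R) (T : nat).
Variables (arm : nat -> Omega -> 'I_K) (reward feedback : nat -> {RV P >-> bool}).

Definition history (t : nat) (w : Omega) : seq ('I_K * bool * bool) :=
  [seq (arm s w, reward s w, feedback s w) | s <- iota 0 t].

Definition observed (h : seq ('I_K * bool * bool)) : seq ('I_K * bool) :=
  [seq (x.1.1, x.2) | x <- h].

(* Conditional laws are given in product form, P(E, past) = P(past) p.
   [run_select]: given the full past, the law of the pulled arm is a function
   [pi] of the observed past, i.e., the learner uses past feedback and internal
   randomization only. [run_reward] and [run_feedback] say that in each round,
   independently of the past, the reward is Bernoulli and the feedback is the
   randomized response to it. *)
Record bandit_run eps mu T : Prop := BanditRun {
  run_measurable_arm : forall t a, measurable (arm t @^-1` [set a]) ;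
  run_select : exists pi : seq ('I_K * bool) -> 'I_K -> R,
    forall t h a, (t < T)%N ->
    P [set w | history t w = h /\ arm t w = a] =
    (P [set w | history t w = h] * (pi (observed h) a)%:E)%E ;
  run_reward : forall t h a r, (t < T)%N ->
    P [set w | [/\ history t w = h, arm t w = a & reward t w = r]] =
    (P [set w | history t w = h /\ arm t w = a] *
     (bernoulli_pmf (mu a) r)%:E)%E ;
  run_feedback : forall t h a r f, (t < T)%N ->
    P [set w | [/\ history t w = h, arm t w = a, reward t w = r &
                   feedback t w = f]] =
    (P [set w | [/\ history t w = h, arm t w = a & reward t w = r]] *
     (rand_resp eps r f)%:E)%E }.

Definition regret mu (best : 'I_K) T : \bar R :=
  ('E_P[fun w => (mu best * T%:R - \sum_(t < T) (reward t w)%:R)%R])%E.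

Definition klucb_cf_run eps mu (f : nat -> R) T : Prop :=
  bandit_run eps mu T /\
  forall t w, (t < T)%N ->
    klucb_rule eps f (observed (history t w)) (arm t w).

(* [theta t a] is the sample drawn for arm [a] in round [t]; the second clause
   is the joint conditional law of [theta t] given the past, a product of Beta
   laws. *)
Definition ts_cf_run eps mu (theta : nat -> 'I_K -> {RV P >-> R}) T : Prop :=
  [/\ bandit_run eps mu T,
      forall t h (B : 'I_K -> set R), (t < T)%N ->
        (forall a, measurable (B a)) ->
        P [set w | history t w = h /\ forall a, B a (theta t a w)] =
        (P [set w | history t w = h] *
         (\prod_(a < K) fine (beta_prob (nsuccess (observed h) a).+1
                                        (nfail (observed h) a).+1 (B a)))%:E)%E &
      forall t w, (t < T)%N -> ts_rule eps (fun a => theta t a w) (arm t w)].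

End runs.

(* Main.v *)
(* Proof idea.  The leading constant 2 / Delta_a exceeds the optimal one by a
   factor at least 4, so the remainder can be taken constant.  It suffices that
   every suboptimal arm is pulled 2 ln T / D^2 + O(1) times on average, where D
   is the gap between the two feedback means lambda_1 and lambda_a.

   The pulls of an arm cut the adaptive process into binomial samples: the
   expected number of rounds in which arm a is pulled while its counters are
   (n, s) is at most the binomial weight C(n,s) lambda_a^s (1-lambda_a)^(n-s),
   and so is the probability that the counters are (n, s) at a fixed time.
   Combined with the weak Pinsker bound kl(p, q) >= (p - q)^2 and the method of
   types, this turns each bad event into a convergent double series.

   kl-UCB-CF: comparing the indices with a level y < lambda_1 makes the
   likelihood of each underestimating sample of arm 1 exponentially small in n
   on top of the factor e^(-f(t)), and the sum of e^(-f(t)) = 1/(t ln^3 t)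
   converges; no peeling is needed.

   TS-CF: if all samples are below y, exchange the event theta_1 <= y for
   theta_1 > y; this costs the odds (1-p)/p, p = P(theta_1 > y), and makes arm 1
   the pulled arm.  The odds are summable against the binomial weights because
   p is at least a multiple of the binomial weight of parameter y. *)
Require Import Defs.
From mathcomp Require Import all_boot all_order all_algebra.
From mathcomp Require Import all_classical all_reals all_analysis.
From mathcomp Require Import measurable_realfun ring lra zify.

Set Implicit Arguments.
Unset Strict Implicit.
Unset Printing Implicit Defensive.

Import Order.TTheory GRing.Theory Num.Theory.
Import numFieldNormedType.Exports.

Local Open Scope classical_set_scope.
Local Open Scope ring_scope.

(** * Binary divergence and binomial weights *)

Section bernoulli_kl.
Context {R : realType}.
Implicit Types p q x y z : R.

Definition bkl p q : R := p * ln (p / q) + (1 - p) * ln ((1 - p) / (1 - q)).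

(** For [q] strictly inside the unit interval no infinite value arises, and at [p] in {0, 1} the
    zero factor kills the logarithm, so the conventions agree with the total functions. *)
Lemma kl_bkl p q : 0 < q < 1 -> kl p q = (bkl p q)%:E.
Proof.
move=> /andP[q0 q1]; rewrite /kl /kl_term /bkl (gt_eqF q0).
have -> : (1 - q == 0) = false by rewrite gt_eqF // subr_gt0.
case: eqP => [->|_]; case: eqP => [->|_]; rewrite ?mul0r ?add0r ?addr0 ?adde0 //.
Qed.

(** Apply [ln u <= u - 1] to u = sqrt (q / p). Summed over the two outcomes, this bounds the
    divergence below by twice one minus the Hellinger affinity. *)
Lemma hellinger_term p q : 0 <= p -> 0 < q ->
  2 * p - 2 * (Num.sqrt p * Num.sqrt q) <= p * ln (p / q).
Proof.
rewrite le_eqVlt => /predU1P[<- q0|p0 q0].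
  by rewrite mulr0 sqrtr0 !mul0r mulr0 subrr.
have sp : 0 < Num.sqrt p by rewrite sqrtr_gt0.
have sq : 0 < Num.sqrt q by rewrite sqrtr_gt0.
have r0 : 0 < Num.sqrt q / Num.sqrt p by rewrite divr_gt0.
have -> : p / q = ((Num.sqrt q / Num.sqrt p) ^+ 2)^-1.
  by rewrite expr_div_n !sqr_sqrtr ?ltW // invf_div.
rewrite lnV ?posrE ?exprn_gt0 // lnXn //.
have /le_ln1Dx : -1 < Num.sqrt q / Num.sqrt p - 1 by lra.
rewrite addrC subrK => h.
have hp : p * ln (Num.sqrt q / Num.sqrt p) <= p * (Num.sqrt q / Num.sqrt p - 1).
  by rewrite ler_pM2l.
have e : p * (Num.sqrt q / Num.sqrt p - 1) = Num.sqrt p * Num.sqrt q - p.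
  rewrite -{1}(@sqr_sqrtr _ p) ?ltW // -{4}(@sqr_sqrtr _ p) ?ltW //.
  by field; rewrite gt_eqF.
by rewrite e in hp; rewrite mulr2n; lra.
Qed.

(* The Hellinger affinity u = a b + a' b' of the square roots satisfies
   KL >= 2 (1 - u) >= 1 - u^2 >= (total variation)^2. *)
Lemma bkl_ge_sqr p q : 0 <= p <= 1 -> 0 < q < 1 -> (p - q) ^+ 2 <= bkl p q.
Proof.
move=> /andP[p0 p1] /andP[q0 q1].
have h1 := hellinger_term p0 q0.
have p0' : 0 <= 1 - p by lra.
have q0' : 0 < 1 - q by lra.
have h2 := hellinger_term p0' q0'.
have := sqr_sqrtr p0; have := sqr_sqrtr p0'.
have := sqr_sqrtr (ltW q0); have := sqr_sqrtr (ltW q0').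
move: h1 h2; rewrite -/(bkl p q).
set a := Num.sqrt p; set b := Num.sqrt q.
set a' := Num.sqrt (1 - p); set b' := Num.sqrt (1 - q).
move=> h1 h2 eb' eb ea' ea.
suff : (p - q) ^+ 2 <= 2 - 2 * (a * b + a' * b').
  by move=> /le_trans; apply; rewrite /bkl; lra.
have eq1 : p - q = (a * b' - a' * b) * (a * b' + a' * b).
  have -> : (a * b' - a' * b) * (a * b' + a' * b) =
    a ^+ 2 * b' ^+ 2 - a' ^+ 2 * b ^+ 2 by ring.
  by rewrite ea eb ea' eb'; ring.
have le1 : (a * b' + a' * b) ^+ 2 <= 1.
  have -> : 1 = (a ^+ 2 + a' ^+ 2) * (b ^+ 2 + b' ^+ 2) by rewrite ea eb ea' eb'; ring.
  by rewrite -subr_ge0 (_ : _ - _ = (a * b - a' * b') ^+ 2) ?sqr_ge0 //; ring.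
have eq2 : (a * b' - a' * b) ^+ 2 = 1 - (a * b + a' * b') ^+ 2.
  have -> : 1 = (a ^+ 2 + a' ^+ 2) * (b ^+ 2 + b' ^+ 2) by rewrite ea eb ea' eb'; ring.
  by ring.
rewrite eq1 exprMn.
apply: (@le_trans _ _ ((a * b' - a' * b) ^+ 2)).
  by rewrite ler_piMr ?sqr_ge0.
rewrite eq2 -subr_ge0 (_ : _ - _ = (1 - (a * b + a' * b')) ^+ 2) ?sqr_ge0 //.
by ring.
Qed.

(** Extends the weak Pinsker bound to [q] in {0, 1}, where the divergence is [+oo] unless
    [p = q]. *)
Lemma kl_ge_sqr p q : 0 <= p <= 1 -> 0 <= q <= 1 -> (((p - q) ^+ 2)%:E <= kl p q)%E.
Proof.
move=> p01 /andP[]; rewrite le_eqVlt => /predU1P[<- _|q0].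
  rewrite /kl /kl_term eqxx !subr0 oner_eq0 divr1.
  case: eqP => [->|_]; last by case: eqP; rewrite leey.
  by rewrite !subr0 oner_eq0 ln1 mulr0 expr0n /= adde0.
rewrite le_eqVlt => /predU1P[->|q1]; last first.
  by rewrite kl_bkl ?q0 ?q1 // lee_fin bkl_ge_sqr // q0.
rewrite /kl /kl_term oner_eq0 subrr eqxx divr1.
have [->|pn1] := eqVneq p 1.
  by rewrite subrr eqxx oner_eq0 ln1 mulr0 expr0n /= adde0.
have -> : (1 - p == 0) = false by rewrite subr_eq0 eq_sym (negbTE pn1).
by case: eqP; rewrite ?addey ?leey.
Qed.

(* log of the likelihood ratio per sample, at empirical mean z *)
Definition tilt z y q : R := z * ln (y / q) + (1 - z) * ln ((1 - y) / (1 - q)).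

Lemma tilt_diag y q : tilt y y q = bkl y q. Proof. by []. Qed.

(** [tilt] is affine in [z], with slope [ln (y / q) - ln ((1 - y) / (1 - q))], nonpositive when
    [y <= q]. *)
Lemma le_tilt z z' y q : 0 < y < 1 -> 0 < q < 1 -> y <= q -> z <= z' ->
  tilt z' y q <= tilt z y q.
Proof.
move=> /andP[y0 y1] /andP[q0 q1] yq zz.
have h1 : ln (y / q) <= 0 by rewrite ln_le0 // ler_pdivrMr // mul1r.
have h2 : 0 <= ln ((1 - y) / (1 - q)).
  by rewrite ln_ge0 // ler_pdivlMr ?subr_gt0 // mul1r; lra.
rewrite /tilt; nra.
Qed.

Lemma likelihood_ratio (n s : nat) y q : 0 < y < 1 -> 0 < q < 1 ->
    (s <= n)%N ->
  q ^+ s * (1 - q) ^+ (n - s) =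
  expR (- (n%:R * tilt (s%:R / n%:R) y q)) * (y ^+ s * (1 - y) ^+ (n - s)).
Proof.
move=> /andP[y0 y1] /andP[q0 q1] sn.
have q1' : 0 < 1 - q by lra.
have y1' : 0 < 1 - y by lra.
have e : n%:R * tilt (s%:R / n%:R) y q =
    s%:R * ln (y / q) + (n - s)%:R * ln ((1 - y) / (1 - q)).
  have [n0|n0] := posnP n.
    by move: sn; rewrite n0 leqn0 => /eqP ->; rewrite !mul0r addr0.
  rewrite /tilt natrB //; field.
  by rewrite pnatr_eq0 -lt0n.
rewrite e opprD expRD -!mulrN -!lnV ?posrE ?divr_gt0 // !invf_div.
rewrite !expRM_natl !lnK ?posrE ?divr_gt0 // !expr_div_n.
by field; rewrite ?expf_neq0 ?gt_eqF.
Qed.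

Definition binw q (n s : nat) : R := 'C(n, s)%:R * (q ^+ s * (1 - q) ^+ (n - s)).

Lemma binw_ge0 q n s : 0 <= q <= 1 -> 0 <= binw q n s.
Proof.
by move=> /andP[q0 q1]; rewrite !mulr_ge0 ?exprn_ge0 // subr_ge0.
Qed.

Lemma sum_binw q n : \sum_(s < n.+1) binw q n s = 1.
Proof.
rewrite (eq_bigr (fun s : 'I_n.+1 => ((1 - q) ^+ (n - s) * q ^+ s) *+ 'C(n, s))).
  by rewrite -exprDn subrK expr1n.
by move=> s _; rewrite /binw -mulr_natl; ring.
Qed.

Lemma binw_le1 q n s : 0 <= q <= 1 -> (s <= n)%N -> binw q n s <= 1.
Proof.
move=> q01 sn; rewrite -(sum_binw q n) -ltnS in sn *.
rewrite (bigD1 (Ordinal sn)) //= lerDl.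
by apply: sumr_ge0 => i _; exact: binw_ge0.
Qed.

(** Condition on the last of the [n.+1] trials. *)
Lemma binw_pascal q n s :
  binw q n.+1 s.+1 = q * binw q n s + (1 - q) * binw q n s.+1.
Proof.
rewrite /binw subSS binS natrD.
have [sn|ns] := ltnP s n.
  by rewrite -(subnSK sn) !exprS; ring.
(* Here [n <= s]: both truncated differences are 0 and the terms in ['C(n, s.+1)] vanish. *)
rewrite exprS.
by rewrite (@bin_small n s.+1) //; ring.
Qed.

Lemma binwS0 q n : binw q n.+1 0 = (1 - q) * binw q n 0.
Proof. by rewrite /binw !subn0 !bin0 exprS; ring. Qed.

Lemma binw_tilt n s y q : 0 < y < 1 -> 0 < q < 1 -> (s <= n)%N ->
  binw q n s = expR (- (n%:R * tilt (s%:R / n%:R) y q)) * binw y n s.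
Proof.
by move=> y01 q01 sn; rewrite /binw (likelihood_ratio y01 q01 sn); ring.
Qed.

Lemma frac_itv (n s : nat) : (s <= n)%N -> 0 <= (s%:R / n%:R : R) <= 1.
Proof.
move=> sn; rewrite divr_ge0 //=.
have [->|n0] := posnP n; first by rewrite invr0 mulr0.
by rewrite ler_pdivrMr ?ltr0n // mul1r ler_nat.
Qed.

(** Method of types: change the parameter to the empirical mean [s / n]. The new weight is at most
    1, and the likelihood ratio is exactly the exponential of the divergence. *)
Lemma binw_le_expR n s q : 0 < q < 1 -> (s <= n)%N ->
  binw q n s <= expR (- (n%:R * bkl (s%:R / n%:R) q)).
Proof.
move=> q01 sn.
have [n0|n0] := posnP n.
  by rewrite n0 mul0r oppr0 expR0 -n0 binw_le1 // !ltW //; case/andP: q01.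
set p : R := s%:R / n%:R.
(* The change of parameter requires [p] strictly inside; samples of failures only or of successes
   only are computed directly. *)
have [/andP[p0 p1]|] := boolP (0 < p < 1).
  rewrite (@binw_tilt n s p) ?p0 // ler_piMr ?expR_ge0 // binw_le1 //.
  by rewrite !ltW.
case/andP: q01 => q0 q1.
have n0' : n%:R != 0 :> R by rewrite pnatr_eq0 -lt0n.
have q1' : 0 < 1 - q by lra.
have [s0|s0] := posnP s.
  rewrite /binw /bkl /p s0 mul0r subr0 mul0r add0r !mul1r bin0 mul1r subn0.
  by rewrite -mulrN -lnV ?posrE ?invr_gt0 // invrK expRM_natl lnK // expr0 mul1r.
have [sn'|sn'] := ltnP s n.
  by rewrite /p divr_gt0 ?ltr0n // ltr_pdivrMr ?ltr0n // mul1r ltr_nat sn'.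
have -> : s = n by apply/eqP; rewrite eqn_leq sn sn'.
rewrite /binw /bkl /p; have -> : s = n by apply/eqP; rewrite eqn_leq sn sn'.
rewrite divff // subrr mul0r addr0 mul1r binn subnn expr0 mulr1 !mul1r.
by rewrite -mulrN -lnV ?posrE ?invr_gt0 // invrK expRM_natl lnK.
Qed.

Lemma binw_le_gap n s q x : 0 < q < 1 -> (s <= n)%N -> 0 <= x ->
  x <= `|s%:R / n%:R - q| -> binw q n s <= expR (- (n%:R * x ^+ 2)).
Proof.
move=> q01 sn x0 xle; apply: (le_trans (binw_le_expR q01 sn)).
rewrite ler_expR lerN2 ler_wpM2l //.
apply: le_trans (bkl_ge_sqr (frac_itv sn) q01).
by rewrite -[leRHS]real_normK ?num_real // ler_pXn2r ?nnegrE.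
Qed.

End bernoulli_kl.

(** * Convergent series *)

Section series_bounds.
Context {R : realType}.
Implicit Types r u L : R.

Lemma natr_le_expR r : 0 < r -> forall n : nat,
  n.+1%:R <= (1 + r^-1) * expR (r * n%:R).
Proof.
move=> r0 n; apply: (@le_trans _ _ ((1 + r^-1) * (1 + r * n%:R))).
  rewrite (_ : (1 + r^-1) * (1 + r * n%:R) = n.+1%:R + (r^-1 + r * n%:R)).
    by rewrite lerDl addr_ge0 ?invr_ge0 ?mulr_ge0 // ltW.
  by rewrite -natr1; field; rewrite gt_eqF.
by rewrite ler_pM2l ?expR_ge1Dx // addr_gt0 // invr_gt0.
Qed.

Lemma sum_expR_le r (T : nat) : 0 < r ->
  \sum_(n < T) expR (- (r * n%:R)) <= (1 - expR (- r))^-1.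
Proof.
move=> r0; have r1 : 0 < 1 - expR (- r) by rewrite subr_gt0 expR_lt1 oppr_lt0.
rewrite -[leRHS]mul1r ler_pdivlMr //.
under eq_bigr do rewrite -mulNr expRM_natr.
have := subrX1 (expR (- r)) T.
have : 0 <= expR (- r) ^+ T by rewrite exprn_ge0 // expR_ge0.
by set S := \sum_(_ < _) _ => h1 h2; lra.
Qed.

(** Raise the linear bound [natr_le_expR], taken at the rate r divided by the degree, to the power
    of the degree. *)
Lemma poly_expR_bounded (k : nat) r : 0 < r ->
  exists2 C : R, 0 < C & forall n : nat, n.+1%:R ^+ k * expR (- (n%:R * r)) <= C.
Proof.
move=> r0; case: k => [|k].
  exists 1 => // n; rewrite expr0 mul1r expR_le1 oppr_le0 mulr_ge0 //.
  exact: ltW.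
set r' := r / k.+1%:R; have r'0 : 0 < r' by rewrite divr_gt0.
exists ((1 + r'^-1) ^+ k.+1) => [|n].
  by rewrite exprn_gt0 // addr_gt0 // invr_gt0.
rewrite expRN ler_pdivrMr ?expR_gt0 //.
have -> : expR (n%:R * r) = expR (r' * n%:R) ^+ k.+1.
  by rewrite -expRM_natr; congr expR; rewrite /r' mulrAC divfK ?pnatr_eq0 // mulrC.
rewrite -exprMn ler_pXn2r ?nnegrE ?natr_le_expR //.
by rewrite mulr_ge0 ?expR_ge0 // addr_ge0 // invr_ge0 ltW.
Qed.

(** Half of the rate absorbs the polynomial; the other half leaves a geometric series. *)
Lemma sum_poly_expR_le (k : nat) r : 0 < r ->
  exists2 C : R, 0 < C &
    forall T : nat, \sum_(n < T) n.+1%:R ^+ k * expR (- (n%:R * r)) <= C.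
Proof.
move=> r0; have r20 : 0 < r / 2 by rewrite divr_gt0.
have [C C0 hC] := poly_expR_bounded k r20.
exists (C * (1 - expR (- (r / 2)))^-1) => [|T].
  by rewrite mulr_gt0 // invr_gt0 subr_gt0 expR_lt1 oppr_lt0.
apply: (@le_trans _ _ (C * \sum_(n < T) expR (- (r / 2 * n%:R)))).
  rewrite mulr_sumr; apply: ler_sum => n _.
  have -> : - (n%:R * r) = - (n%:R * (r / 2)) + - (r / 2 * n%:R) by field.
  by rewrite expRD mulrA ler_wpM2r ?expR_ge0.
by rewrite ler_pM2l // sum_expR_le.
Qed.

Lemma sum_lt_le L (T : nat) : 0 <= L ->
  \sum_(n < T) ((n%:R : R) < L)%R%:R <= L + 1.
Proof.
(* The minimum with [T] strengthens the induction: while [T < L], the bound [T] by itself pays for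
   the new term. *)
move=> L0; suff : \sum_(n < T) ((n%:R : R) < L)%R%:R <= Num.min T%:R (L + 1).
  by rewrite le_min => /andP[].
elim: T => [|T IH]; first by rewrite big_ord0 le_min lexx addr_ge0.
rewrite big_ord_recr /=; move: IH; rewrite !le_min => /andP[h1 h2].
case: ltP => [TL|_]; first by rewrite -natr1 -[1%:R]/1; apply/andP; split; lra.
by rewrite addr0 h2 (le_trans h1) // ler_nat.
Qed.

(** Discrete form of the primitive -1 / ln t of 1 / (t ln^2 t), obtained from 1 / t <= ln t - ln (t
    - 1). *)
Lemma inv_ln_telescope (t : nat) : (3 <= t)%N ->
  (t%:R * ln t%:R ^+ 2)^-1 <= (ln t.-1%:R)^-1 - (ln t%:R)^-1 :> R.
Proof.
case: t => [|t] //; rewrite ltnS => t2 /=.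
have t1 : 1 < t%:R :> R by rewrite (ltr_nat R 1).
have t0 : 0 < t%:R :> R by lra.
have s0 : 0 < t.+1%:R :> R by [].
have l0 : 0 < ln (t%:R : R) by exact: ln_gt0.
have ll : ln (t%:R : R) <= ln (t.+1%:R : R) by rewrite ler_ln ?posrE // ler_nat.
have l1 : 0 < ln (t.+1%:R : R) by lra.
have step : (t.+1%:R)^-1 <= ln t.+1%:R - ln t%:R :> R.
  have : ln (1 + - (t.+1%:R)^-1) <= - (t.+1%:R)^-1 :> R.
    by rewrite le_ln1Dx // ltrN2 invf_lt1 // -natr1; lra.
  have -> : 1 + - (t.+1%:R)^-1 = t%:R / t.+1%:R :> R.
    by rewrite -natr1; field; rewrite natr1.
  by rewrite ln_div ?posrE // lerNr opprB.
have -> : (ln t%:R)^-1 - (ln t.+1%:R)^-1 =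
    (ln t.+1%:R - ln t%:R) / (ln t%:R * ln t.+1%:R) :> R.
  by field; rewrite !gt_eqF.
rewrite invfM; apply: ler_pM => //.
  by rewrite invr_ge0 exprn_ge0 // ltW.
by rewrite lef_pV2 ?posrE ?mulr_gt0 ?exprn_gt0 // expr2 ler_wpM2r // ltW.
Qed.

(** The three free terms are at most 1 each because [f] is nonnegative. Beyond them, one of the
    three logarithms in 1 / (t ln^3 t) is bounded by [ln 2] and the rest telescopes. *)
Lemma klucb_exploration_sum (f : nat -> R) (T : nat) : klucb_exploration f ->
  \sum_(t < T) expR (- f t) <= 3 + (ln 2)^-1 * (ln 2)^-1.
Proof.
case=> fE f0 _.
have l2 : 0 < ln (2 : R) by rewrite ln_gt0 // ltr1n.
suff H : \sum_(t < T.+3) expR (- f t) <=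
    3 + (ln 2)^-1 * ((ln 2)^-1 - (ln T.+2%:R)^-1).
  apply: (@le_trans _ _ (\sum_(t < T.+3) expR (- f t))).
    by rewrite !big_ord_recr /= -!addrA lerDl !addr_ge0 ?expR_ge0.
  apply: le_trans H _; rewrite lerD2l ler_wpM2l ?invr_ge0 ?(ltW l2) //.
  by rewrite gerBl invr_ge0 ln_ge0 // ler1n.
have small t : expR (- f t) <= 1 by rewrite expR_le1 oppr_le0.
elim: T => [|T IH].
  rewrite subrr mulr0 addr0; apply: (@le_trans _ _ (\sum_(t < 3) 1)).
    by apply: ler_sum => t _; exact: small.
  by rewrite sumr_const card_ord.
rewrite big_ord_recr /=.
have l3 : 0 < ln (T.+3%:R : R) by rewrite ln_gt0 // ltr1n.
suff : expR (- f T.+3) <= (ln 2)^-1 * ((ln T.+2%:R)^-1 - (ln T.+3%:R)^-1).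
  by move: IH => ?; lra.
rewrite fE // expRN expRD (_ : 3 * _ = ln (ln T.+3%:R) * 3%:R); last exact: mulrC.
rewrite expRM_natr !lnK ?posrE // exprS mulrCA invfM.
apply: ler_pM.
- by rewrite invr_ge0 ltW.
- by rewrite invr_ge0 mulr_ge0 ?exprn_ge0 ?(ltW l3).
- by rewrite lef_pV2 ?posrE // ler_ln ?posrE // ler_nat.
- exact: (@inv_ln_telescope T.+3).
Qed.

(* ln u <= 2 sqrt u makes [ln u + 3 ln ln u] at most [1.31 ln u] as soon as
   [ln u >= 400]. *)
Lemma ln_lnln_lt u : expR 400 <= u -> ln u + 3 * ln (ln u) < 131 / 100 * ln u.
Proof.
move=> u0; have u1 : 400 <= ln u.
  by rewrite -[leLHS]expRK ler_ln ?posrE ?expR_gt0 // (lt_le_trans _ u0) ?expR_gt0.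
set v := ln u in u1 *.
have v0 : 0 < v by lra.
set w := Num.sqrt v.
have w2 : w ^+ 2 = v by rewrite sqr_sqrtr // ltW.
have w0 : 0 < w by rewrite sqrtr_gt0.
have w20 : 20 <= w.
  by rewrite leNgt; apply/negP => wl; nra.
by have := ln_sublinear w0; rewrite -w2 lnXn // mulr2n => lw; nra.
Qed.

End series_bounds.

(** * The law of the observed history *)

Section history_law.
Context {R : realType} {K : nat}.
Local Notation round := ('I_K * bool * bool)%type.
Implicit Types (h : seq round) (a : 'I_K) (g : nat -> nat -> R).

Fixpoint hists (t : nat) : seq (seq round) :=
  if t is t'.+1 then [seq rcons h x | h <- hists t', x <- enum {: round}]
  else [:: [::]].

Lemma size_hists t h : h \in hists t -> size h = t.
Proof.
elim: t h => [|t IH] h /=; first by rewrite inE => /eqP ->.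
by case/allpairsP => -[h' x] [/= /IH <- _ ->]; rewrite size_rcons.
Qed.

Lemma mem_hists h : h \in hists (size h).
Proof.
elim/last_ind: h => [|h x IH] //=; rewrite size_rcons /=.
by apply/allpairsP; exists (h, x); rewrite IH mem_enum.
Qed.

Lemma hists_uniq t : uniq (hists t).
Proof.
elim: t => [|t IH] //=; apply: allpairs_uniq => //; first exact: enum_uniq.
by move=> [h x] [h' x'] _ _ /= /rcons_inj [-> ->].
Qed.

(* [p h] is the probability of the history [h], and [q h a] that of [h] followed
   by a pull of [a]. *)
Record history_law (eps : R) (mu : 'I_K -> R) (T : nat)
    (p : seq round -> R) (q : seq round -> 'I_K -> R) : Prop := HistoryLaw {
  law_nil : p [::] = 1 ;
  law_arm_ge0 : forall h a, 0 <= q h a ;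
  law_arm : forall h, p h = \sum_a q h a ;
  law_step : forall h a r f, (size h < T)%N ->
    p (rcons h (a, r, f)) = q h a * bernoulli_pmf (mu a) r * rand_resp eps r f }.

Definition pulls h a : nat := npull (observed h) a.
Definition succs h a : nat := nsuccess (observed h) a.

Lemma pulls_rcons h x a : pulls (rcons h x) a = (pulls h a + (x.1.1 == a))%N.
Proof. by rewrite /pulls /npull /observed map_rcons -cats1 count_cat /= addn0. Qed.

Lemma succs_rcons h x a :
  succs (rcons h x) a = (succs h a + ((x.1.1 == a) && x.2))%N.
Proof.
rewrite /succs /nsuccess /observed map_rcons -cats1 count_cat /= addn0.
by rewrite xpair_eqE eqb_id.
Qed.

Lemma succs_le_pulls h a : (succs h a <= pulls h a)%N.
Proof.
elim/last_ind: h => [|h x IH] //.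
by rewrite succs_rcons pulls_rcons leq_add //; case: (_ == _); case: x.2.
Qed.

Lemma pulls_le_size h a : (pulls h a <= size h)%N.
Proof. by rewrite /pulls /npull (leq_trans (count_size _ _)) // size_map. Qed.

(** Expands a function of the counters over the states (n, s), so that bounds on single states
    transfer to any nonnegative function. *)
Lemma sum_dirac2 g (N S M : nat) : (N < M)%N -> (S <= N)%N ->
  \sum_(n < M) \sum_(s < n.+1) g n s * ((N == n) && (S == s))%:R = g N S.
Proof.
move=> NM SN; rewrite (bigD1 (Ordinal NM)) //= [X in _ + X]big1 ?addr0.
  rewrite -ltnS in SN; rewrite (bigD1 (Ordinal SN)) //= [X in _ + X]big1 ?addr0.
    by rewrite !eqxx mulr1.
  move=> s sS; rewrite eqxx /=; case: eqP => [e|_]; last by rewrite mulr0.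
  by case/eqP: sS; exact: val_inj.
move=> n nN; rewrite big1 // => s _; case: eqP => [e|_]; last by rewrite mulr0.
by case/eqP: nN; exact: val_inj.
Qed.

Variables (eps : R) (mu : 'I_K -> R) (T : nat).
Variables (p : seq round -> R) (q : seq round -> 'I_K -> R).
Hypothesis pq : history_law eps mu T p q.
Hypothesis lam01 : forall a, 0 < corrupt eps (mu a) < 1.
Let lam a := corrupt eps (mu a).

Lemma law_ge0 h : 0 <= p h.
Proof. by rewrite (law_arm pq); apply: sumr_ge0 => a _; exact: law_arm_ge0 pq _ _. Qed.

Lemma law_arm_le h a : q h a <= p h.
Proof.
rewrite (law_arm pq) (bigD1 a) //= lerDl.
by apply: sumr_ge0 => b _; exact: law_arm_ge0 pq _ _.
Qed.

Lemma sum_hists_step t (F : seq round -> R) :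
  \sum_(h <- hists t.+1) F h = \sum_(h <- hists t) \sum_(x : round) F (rcons h x).
Proof.
rewrite /= big_allpairs_dep /=.
by apply: eq_bigr => h _; rewrite big_enum.
Qed.

(** Summing out the hidden reward leaves a Bernoulli feedback of parameter [lam a]. *)
Lemma sum_round h (G : 'I_K -> bool -> R) : (size h < T)%N ->
  \sum_(x : round) p (rcons h x) * G x.1.1 x.2 =
  \sum_a q h a * (lam a * G a true + (1 - lam a) * G a false).
Proof.
move=> hT; have e0 := expR_gt0 eps.
rewrite (eq_bigr (fun x : round => q h x.1.1 * bernoulli_pmf (mu x.1.1) x.1.2 *
    rand_resp eps x.1.2 x.2 * G x.1.1 x.2)); last first.
  by move=> [[a r] f] _; rewrite (law_step pq).
rewrite -(pair_bigA _ (fun y f => q h y.1 * bernoulli_pmf (mu y.1) y.2 *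
    rand_resp eps y.2 f * G y.1 f)) /=.
rewrite -(pair_bigA _ (fun a r => \sum_f q h a * bernoulli_pmf (mu a) r *
    rand_resp eps r f * G a f)) /=.
apply: eq_bigr => a _; rewrite !big_bool /= /rand_resp /= /lam /corrupt.
by field; rewrite !gt_eqF //; lra.
Qed.

Definition mean_at t a g := \sum_(h <- hists t) p h * g (pulls h a) (succs h a).
Definition mean_pull t a g := \sum_(h <- hists t) q h a * g (pulls h a) (succs h a).

Lemma mean_at_ge0 t a g : (forall n s, 0 <= g n s) -> 0 <= mean_at t a g.
Proof. by move=> g0; apply: sumr_ge0 => h _; rewrite mulr_ge0 ?law_ge0. Qed.

Lemma mean_pull_ge0 t a g : (forall n s, 0 <= g n s) -> 0 <= mean_pull t a g.
Proof.
by move=> g0; apply: sumr_ge0 => h _; rewrite mulr_ge0 // (law_arm_ge0 pq).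
Qed.

(** Transition operator of the counters of [a]: the mean of [g] after one more feedback of this
    arm. *)
Definition shift a g n s := lam a * g n.+1 s.+1 + (1 - lam a) * g n.+1 s.

Lemma mean_at_step t a g : (t < T)%N ->
  mean_at t.+1 a g =
  mean_at t a g - mean_pull t a g + mean_pull t a (shift a g).
Proof.
move=> tT; rewrite /mean_at sum_hists_step /mean_pull -sumrB -big_split /=.
apply: eq_big_seq => h /size_hists ht.
transitivity (\sum_(x : round) p (rcons h x) *
   g (pulls h a + (x.1.1 == a))%N (succs h a + ((x.1.1 == a) && x.2))%N).
  by apply: eq_bigr => x _; rewrite pulls_rcons succs_rcons.
rewrite (sum_round (fun b f => g (pulls h a + (b == a))%N
  (succs h a + ((b == a) && f))%N)) ?ht //.
have -> : p h = q h a + \sum_(b | b != a) q h b.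
  by rewrite (law_arm pq) (bigD1 a).
rewrite (bigD1 a) //= eqxx !addn1 addn0.
rewrite (eq_bigr (fun b => q h b * g (pulls h a) (succs h a))).
  by rewrite -mulr_suml /shift; ring.
by move=> b /negbTE ->; rewrite /= !addn0; ring.
Qed.

(** Flow conservation for the counters of [a], which move only when [a] is pulled: summing
    [mean_at_step] over time telescopes. *)
Lemma visit_balance t a g : (t <= T)%N ->
  mean_at t a g + \sum_(u < t) mean_pull u a g =
  g 0%N 0%N + \sum_(u < t) mean_pull u a (shift a g).
Proof.
elim: t => [|t IH] tT.
  by rewrite !big_ord0 !addr0 /mean_at /= big_seq1 (law_nil pq) mul1r.
by rewrite !big_ord_recr /= (addrA (g _ _)) -(IH (ltnW tT)) mean_at_step //; ring.
Qed.


(** Induction on [n]. By [visit_balance], what sits in or leaves the state (n, s) equals the inflow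
    from pulls made with one pull fewer, and this inflow obeys the recursion [binw_pascal]. How the
    learner chooses the pull times is irrelevant. *)
Lemma visit_le n s t a : (t <= T)%N ->
  mean_at t a (fun n' s' => ((n' == n) && (s' == s))%:R) +
  \sum_(u < t) mean_pull u a (fun n' s' => ((n' == n) && (s' == s))%:R) <=
  binw (lam a) n s.
Proof.
move=> tT; have /andP[l0 l1] := lam01 a.
have d0 n' s' m' r' : 0 <= ((n' == m' :> nat) && (s' == r' :> nat))%:R :> R by [].
elim: n s => [|n IH] s; rewrite visit_balance //.
  (* No inflow reaches a state with [n = 0], since [shift] evaluates at a positive number of
     pulls. *)
  rewrite [X in _ + X]big1 ?addr0; last first.
    by move=> u _; rewrite /mean_pull big1 // => h _; rewrite /shift /=; ring.
  by rewrite /binw !expr0; case: s => [|s] //=; rewrite ?bin0 ?mulr1 ?mul0r.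
have IH' r : \sum_(u < t) mean_pull u a (fun n' s' => ((n' == n) && (s' == r))%:R) <=
    binw (lam a) n r.
  by apply: le_trans (IH r); rewrite lerDr mean_at_ge0.
rewrite add0r; case: s => [|s].
  rewrite binwS0; apply: le_trans (_ : _ <= (1 - lam a) *
      \sum_(u < t) mean_pull u a (fun n' s' => ((n' == n) && (s' == 0%N))%:R)) _.
    rewrite mulr_sumr; apply: ler_sum => u _; rewrite /mean_pull mulr_sumr.
    apply: ler_sum => h _; rewrite /shift eqSS andbF /=.
    by rewrite le_eqVlt; apply/orP; left; apply/eqP; ring.
  by rewrite ler_wpM2l // subr_ge0 ltW.
rewrite binw_pascal; apply: le_trans (_ : _ <=
    lam a * \sum_(u < t) mean_pull u a (fun n' s' => ((n' == n) && (s' == s))%:R) +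
    (1 - lam a) * \sum_(u < t) mean_pull u a (fun n' s' => ((n' == n) && (s' == s.+1))%:R)) _.
  rewrite !mulr_sumr -big_split /=; apply: ler_sum => u _.
  rewrite /mean_pull !mulr_sumr -big_split /=; apply: ler_sum => h _; rewrite /shift !eqSS.
  by rewrite le_eqVlt; apply/orP; left; apply/eqP; ring.
by rewrite lerD // ler_wpM2l ?subr_ge0 // ltW.
Qed.

(* Stopping at the pulls of [a] turns the adaptive process into independent
   binomial samples, at no cost. *)
Lemma sum_pulls_le t a g : (t <= T)%N -> (forall n s, 0 <= g n s) ->
  \sum_(u < t) mean_pull u a g <=
  \sum_(n < t) \sum_(s < n.+1) g n s * binw (lam a) n s.
Proof.
move=> tT g0.
apply: (@le_trans _ _ (\sum_(n < t) \sum_(s < n.+1) g n s *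
    \sum_(u < t) mean_pull u a (fun n' s' => ((n' == n) && (s' == s))%:R))); last first.
  apply: ler_sum => n _; apply: ler_sum => s _; rewrite ler_wpM2l //.
  by apply: le_trans (visit_le n s a tT); rewrite lerDr mean_at_ge0.
under [leRHS]eq_bigr do under eq_bigr do rewrite mulr_sumr.
under [leRHS]eq_bigr do rewrite exchange_big /=.
rewrite exchange_big /=; apply: ler_sum => u _.
under [leRHS]eq_bigr do under eq_bigr do rewrite /mean_pull mulr_sumr.
under [leRHS]eq_bigr do rewrite exchange_big /=.
rewrite exchange_big /= /mean_pull big_seq [leRHS]big_seq; apply: ler_sum => h /size_hists hu.
rewrite -{1}(@sum_dirac2 g (pulls h a) (succs h a) t) ?succs_le_pulls //; last first.
  by rewrite (leq_ltn_trans (pulls_le_size h a)) // hu.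
rewrite mulr_sumr; apply: ler_sum => n _; rewrite mulr_sumr; apply: ler_sum => s _.
by rewrite mulrCA.
Qed.

(** Fixed-time counterpart of [sum_pulls_le], using the other summand of [visit_le]. The range
    includes [n = t], as all rounds so far may have pulled [a]. *)
Lemma law_visit_le t a g : (t <= T)%N -> (forall n s, 0 <= g n s) ->
  mean_at t a g <= \sum_(n < t.+1) \sum_(s < n.+1) g n s * binw (lam a) n s.
Proof.
move=> tT g0.
apply: (@le_trans _ _ (\sum_(n < t.+1) \sum_(s < n.+1) g n s *
    mean_at t a (fun n' s' => ((n' == n) && (s' == s))%:R))); last first.
  apply: ler_sum => n _; apply: ler_sum => s _; rewrite ler_wpM2l //.
  apply: le_trans (visit_le n s a tT); rewrite lerDl sumr_ge0 // => u _.
  exact: mean_pull_ge0.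
under [leRHS]eq_bigr do under eq_bigr do rewrite /mean_at mulr_sumr.
under [leRHS]eq_bigr do rewrite exchange_big /=.
rewrite exchange_big /= /mean_at big_seq [leRHS]big_seq; apply: ler_sum => h /size_hists hu.
rewrite -{1}(@sum_dirac2 g (pulls h a) (succs h a) t.+1) ?succs_le_pulls //; last first.
  by rewrite ltnS -hu pulls_le_size.
rewrite mulr_sumr; apply: ler_sum => n _; rewrite mulr_sumr; apply: ler_sum => s _.
by rewrite mulrCA.
Qed.

(** A constant function is fixed by [shift], so its balance reduces to conservation of mass. *)
Lemma law_total t a : (t <= T)%N -> \sum_(h <- hists t) p h = 1.
Proof.
move=> tT; have := visit_balance a (fun _ _ => 1) tT.
have -> : \sum_(u < t) mean_pull u a (shift a (fun _ _ => 1)) = \sum_(u < t) mean_pull u a (fun _ _ => 1).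
  by apply: eq_bigr => u _; apply: eq_bigr => h _; rewrite /shift; ring.
by move/addIr; rewrite /mean_at; under eq_bigr do rewrite mulr1.
Qed.

End history_law.

(** * From the probability space to the law of the history *)

Section finite_partition.
Context {R : realType} {d : measure_display} {Omega : measurableType d}.
Variable P : probability Omega R.

Lemma prob_fin_num A : measurable A -> P A \is a fin_num.
Proof. by move=> mA; exact: fin_num_measure. Qed.

Lemma fine_prob_le A B : measurable A -> measurable B -> A `<=` B ->
  fine (P A) <= fine (P B).
Proof.
by move=> mA mB AB; rewrite fine_le ?prob_fin_num // le_measure ?inE.
Qed.

Lemma fine_prob_ge0 A : 0 <= fine (P A).
Proof. exact/fine_ge0/measure_ge0. Qed.

Lemma fine_prob_partition (Y : eqType) (g : Omega -> Y) (s : seq Y) (A : set Omega) :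
    uniq s -> measurable A ->
    (forall y, measurable (A `&` [set w | g w = y])) ->
    (forall w, A w -> g w \in s) ->
  fine (P A) = \sum_(y <- s) fine (P (A `&` [set w | g w = y])).
Proof.
move=> us mA mg gs.
have -> : A = A `&` [set w | g w \in s].
  by apply/seteqP; split=> [w Aw|w []//]; split=> //=; exact: gs.
(* Measurability is assumed on the fibres only, so that of their finite union is carried along in
   the induction. *)
suff [-> _] : fine (P (A `&` [set w | g w \in s])) =
    \sum_(y <- s) fine (P (A `&` [set w | g w = y])) /\
    measurable (A `&` [set w | g w \in s]).
  apply: eq_big_seq => y ys; congr (fine (P _)); apply/seteqP; split=> w /=.
    by move=> [Aw <-]; split=> //; split=> //; exact: gs.
  by move=> [[]].
elim: s us {gs} => [|y s IH] /=.
  move=> _; rewrite big_nil (_ : _ `&` _ = set0) ?measure0 //.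
  by apply/seteqP; split=> w // [].
move=> /andP[ys /IH[e m]].
have eU : A `&` [set w | g w \in y :: s] =
    (A `&` [set w | g w = y]) `|` (A `&` [set w | g w \in s]).
  apply/seteqP; split=> w /=; rewrite inE.
    by move=> [Aw /predU1P[]]; [left|right].
  by move=> [[Aw ->]|[Aw ->]]; rewrite ?eqxx ?orbT.
rewrite eU; split; last by apply: measurableU => //.
rewrite measureU //; last first.
  apply/seteqP; split=> w //= [[_ gy] [_]]; rewrite gy => yin.
  by rewrite yin in ys.
by rewrite fineD ?prob_fin_num // big_cons e.
Qed.

End finite_partition.

Local Arguments Defs.history : simpl never.

Section run_law.
Context {R : realType} {K : nat} {d : measure_display} {Omega : measurableType d}.
Variables (P : probability Omega R) (eps : R) (mu : 'I_K -> R) (T : nat).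
Variables (arm : nat -> Omega -> 'I_K) (reward feedback : nat -> {RV P >-> bool}).
Hypothesis run : bandit_run arm reward feedback eps mu T.
Local Notation round := ('I_K * bool * bool)%type.
Local Notation history := (history arm reward feedback).
Implicit Types (h : seq round) (a : 'I_K).

Definition hist_prob h : R := fine (P [set w | history (size h) w = h]).
Definition pull_prob h a : R :=
  fine (P [set w | history (size h) w = h /\ arm (size h) w = a]).

Lemma size_history t w : size (history t w) = t.
Proof. by rewrite size_map size_iota. Qed.

Lemma historyS t w :
  history t.+1 w = rcons (history t w) (arm t w, reward t w, feedback t w).
Proof. by rewrite /Defs.history -addn1 iotaD map_cat /= cats1. Qed.

Lemma measurable_arm_eq t a : measurable [set w | arm t w = a].
Proof. exact: run_measurable_arm run t a. Qed.

Lemma measurable_rv_eq (X : {RV P >-> bool}) b : measurable [set w | X w = b].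
Proof. exact: (@measurable_funPTI _ _ _ _ X [set b]). Qed.

Lemma measurable_history t h : measurable [set w | history t w = h].
Proof.
elim: t h => [|t IH] h.
  have [->|hn] := eqVneq h [::]; first by rewrite (_ : [set w | _] = setT) //; apply/seteqP; split.
  rewrite (_ : [set w | _] = set0) //; apply/seteqP; split=> w //= e.
  by rewrite -e in hn.
case/lastP: h => [|h [[a r] f]].
  by rewrite (_ : [set w | _] = set0) //; apply/seteqP; split=> w //.
rewrite (_ : [set w | _] = [set w | history t w = h] `&` ([set w | arm t w = a] `&`
    ([set w | reward t w = r] `&` [set w | feedback t w = f]))).
  apply: measurableI => //; apply: measurableI; first exact: measurable_arm_eq.
  by apply: measurableI; exact: measurable_rv_eq.
apply/seteqP; split=> w /=; rewrite historyS.
  by move=> /rcons_inj [-> -> -> ->].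
by move=> [-> [-> [-> ->]]].
Qed.

Lemma measurable_pull t h a : measurable [set w | history t w = h /\ arm t w = a].
Proof.
exact: measurableI (measurable_history t h) (measurable_arm_eq t a).
Qed.

Lemma hist_prob_pulls h : hist_prob h = \sum_a pull_prob h a.
Proof.
rewrite /hist_prob (@fine_prob_partition _ _ _ P _ (arm (size h)) (enum 'I_K)).
- by rewrite big_enum.
- exact: enum_uniq.
- exact: measurable_history.
- by move=> a; exact: measurable_pull.
- by move=> w _; rewrite mem_enum.
Qed.

Lemma run_history_law : history_law eps mu T hist_prob pull_prob.
Proof.
split.
- rewrite /hist_prob (_ : [set w | _] = setT) ?probability_setT //.
  by apply/seteqP; split.
- by move=> h a; exact: fine_prob_ge0.
- exact: hist_prob_pulls.
move=> h a r f hT; rewrite /hist_prob size_rcons /pull_prob.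
rewrite (_ : [set w | _] = [set w | [/\ history (size h) w = h, arm (size h) w = a,
   reward (size h) w = r & feedback (size h) w = f]]).
  rewrite (run_feedback run) // (run_reward run) // -muleA -EFinM.
  rewrite fineM ?prob_fin_num //; last exact: measurable_pull.
  by rewrite /= mulrA.
apply/seteqP; split=> w /=; rewrite historyS.
  by move=> /rcons_inj [-> -> -> ->].
by move=> [-> -> -> ->].
Qed.

Lemma history_in_hists t w : history t w \in hists t.
Proof. by rewrite -[t in hists t](size_history t w) mem_hists. Qed.

(** Total probability over the past, then over the pulled arm. *)
Lemma reward_prob t : (t < T)%N ->
  fine (P [set w | reward t w = true]) =
  \sum_(h <- hists t) \sum_a pull_prob h a * mu a.
Proof.
move=> tT.
rewrite (@fine_prob_partition _ _ _ P _ (fun w => history t w) (hists t));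
  last 4 first.
- exact: hists_uniq.
- exact: measurable_rv_eq.
- by move=> h; apply: measurableI; [exact: measurable_rv_eq|exact: measurable_history].
- by move=> w _; exact: history_in_hists.
apply: eq_big_seq => h /size_hists ht.
rewrite (@fine_prob_partition _ _ _ P _ (arm t) (enum 'I_K)); last 4 first.
- exact: enum_uniq.
- by apply: measurableI; [exact: measurable_rv_eq|exact: measurable_history].
- move=> a; apply: measurableI; last exact: measurable_arm_eq.
  by apply: measurableI; [exact: measurable_rv_eq|exact: measurable_history].
- by move=> w _; rewrite mem_enum.
rewrite big_enum /=; apply: eq_bigr => a _; rewrite /pull_prob ht.
rewrite (_ : _ `&` _ = [set w | [/\ history t w = h, arm t w = a & reward t w = true]]).
  rewrite (run_reward run) // fineM ?prob_fin_num //; exact: measurable_pull.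
by apply/seteqP; split=> w /= => [[[-> ->] ->]|[-> -> ->]].
Qed.

Lemma Lfun_indic (A : set Omega) : measurable A -> (\1_A : Omega -> R) \in Lfun P 1.
Proof.
move=> mA; apply/Lfun1_integrable.
exact: integrable_indic.
Qed.

Lemma expected_regret (c : R) :
  'E_P[fun w => (c - \sum_(t < T) (reward t w)%:R)%R]%E =
  (c - \sum_(t < T) fine (P [set w | reward t w = true]))%:E.
Proof.
pose X := [seq (\1_[set w | reward (val t) w = true] : Omega -> R) | t <- enum 'I_T].
have XL Y : Y \in X -> Y \in Lfun P 1.
  by case/mapP => t _ ->; apply: Lfun_indic; exact: measurable_rv_eq.
have sumL (s : seq (Omega -> R)) : {in s, forall Y, Y \in Lfun P 1} ->
    (\sum_(Y <- s) Y : Omega -> R) \in Lfun P 1.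
  elim: s => [|Y s IH] hs; first by rewrite big_nil rpred0.
  rewrite big_cons; apply: rpredD; first by rewrite hs ?mem_head.
  by apply: IH => Z Zs; rewrite hs // inE Zs orbT.
rewrite (_ : (fun w => _) = cst c \- (\sum_(Y <- X) Y)); last first.
  apply/funext => w /=; congr (_ - _); rewrite fct_sumE big_map big_enum /=.
  apply: eq_bigr => t _; rewrite indicE; congr (nat_of_bool _)%:R.
  apply/idP/idP => [h|]; first by rewrite inE.
  by rewrite inE.
rewrite expectationB; last 2 first.
- exact: Lfun_cst.
- exact: sumL.
rewrite expectation_cst expectation_sum; last exact: XL.
rewrite big_map big_enum /= EFinB; congr (_ - _)%E.
rewrite -sumEFin; apply: eq_bigr => t _.
by rewrite expectation_indic ?fineK ?prob_fin_num //; exact: measurable_rv_eq.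
Qed.

Definition exp_pulls a : R :=
  \sum_(t < T) \sum_(h <- hists t) pull_prob h a.

Lemma regret_pulls (best : 'I_K) :
  regret reward mu best T = (\sum_(a < K) (mu best - mu a) * exp_pulls a)%:E.
Proof.
rewrite /regret expected_regret; congr EFin.
rewrite (eq_bigr (fun t : 'I_T => \sum_(h <- hists t) \sum_a pull_prob h a * mu a));
  last by move=> t _; rewrite reward_prob.
(* The histories of each round have total mass one, so the benchmark becomes a sum over the same
   histories and arms as the collected reward. *)
have -> : mu best * T%:R = \sum_(t < T) \sum_(h <- hists t) \sum_a pull_prob h a * mu best.
  rewrite (eq_bigr (fun=> mu best)) ?sumr_const ?card_ord ?mulr_natr // => t _.
  under eq_bigr do rewrite -mulr_suml -hist_prob_pulls.
  by rewrite -mulr_suml (law_total run_history_law best) ?mul1r // ltnW.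
rewrite -sumrB.
under [RHS]eq_bigr do rewrite /exp_pulls mulr_sumr.
rewrite [RHS]exchange_big /=; apply: eq_bigr => t _.
under [RHS]eq_bigr do rewrite mulr_sumr.
rewrite [RHS]exchange_big /= -sumrB; apply: eq_bigr => h _.
by rewrite -sumrB; apply: eq_bigr => a _; ring.
Qed.

End run_law.

(** * Tails of Beta laws with integer parameters *)

Section beta_tails.
Context {R : realType}.
Implicit Types (x y c u v : R) (s m : nat).
Local Notation mu := (@lebesgue_measure R).

Lemma beta_funV s m :
  (beta_fun s.+1 m.+1)^-1 = (s + m).+1%:R * 'C(s + m, s)%:R :> R.
Proof.
rewrite beta_fun_fact invf_div factS natrM -mulrA; congr (_ * _).
have := @bin_fact (s + m) s (leq_addr _ _); rewrite addKn => <-.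
rewrite natrM mulfK // pnatr_eq0 -lt0n muln_gt0 !fact_gt0 //.
Qed.

Lemma XMonemXE s m x : XMonemX s m x = x ^+ s * (1 - x) ^+ m.
Proof. by []. Qed.

(** The Beta kernel increases up to its mode [s / (s + m)]. The log-likelihood ratio of [y] to [x]
    is a multiple of [tilt], which for [x <= y] increases in the empirical mean and is a divergence
    at [y], hence nonnegative beyond. *)
Lemma XMonemX_homo s m x y : 0 <= x -> x <= y -> y < 1 ->
  (s + m)%:R * y <= s%:R -> XMonemX s m x <= XMonemX s m y.
Proof.
rewrite le_eqVlt => /predU1P[<-|x0] xy y1 hs.
  rewrite !XMonemXE; case: s hs => [|s] hs; last first.
    by rewrite expr0n /= mul0r mulr_ge0 ?exprn_ge0 // ?subr_ge0; lra.
  rewrite !expr0 !mul1r subr0 expr1n.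
  case: m hs => [|m]; first by rewrite expr0.
  rewrite add0n pmulr_rle0 // => y0; have -> : y = 0 by lra.
  by rewrite subr0 expr1n.
have [n0|n0] := posnP (s + m)%N.
  by move: n0 => /eqP; rewrite addn_eq0 => /andP[/eqP -> /eqP ->]; rewrite !XMonemXE !expr0.
have n0' : 0 < (s + m)%:R :> R by rewrite ltr0n.
have y0 : 0 < y by lra.
have yz : y <= s%:R / (s + m)%:R by rewrite ler_pdivlMr // mulrC.
have y01 : 0 < y < 1 by rewrite y0.
have x01 : 0 < x < 1 by rewrite x0; lra.
have := @likelihood_ratio _ (s + m) s y x y01 x01 (leq_addr _ _).
rewrite addKn !XMonemXE => ->.
rewrite ler_piMl ?mulr_ge0 ?exprn_ge0 ?(ltW y0) ?subr_ge0 ?(ltW y1) //.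
rewrite expR_le1 oppr_le0 mulr_ge0 //.
have h1 : 0 <= ln (y / x) by rewrite ln_ge0 // ler_pdivlMr // mul1r.
have h2 : ln ((1 - y) / (1 - x)) <= 0.
  by rewrite ln_le0 // ler_pdivrMr ?mul1r; lra.
have : 0 <= tilt y y x.
  rewrite tilt_diag; apply: le_trans (bkl_ge_sqr _ x01); first exact: sqr_ge0.
  by rewrite !ltW.
rewrite /tilt; nra.
Qed.

Lemma beta_prob_le s m c (U : set (measurableTypeR R)) : measurable U -> 0 <= c ->
  (forall x, U x -> 0 <= x <= 1 -> XMonemX s m x <= c) ->
  fine (beta_prob s.+1 m.+1 U) <= c / beta_fun s.+1 m.+1.
Proof.
move=> mU c0 hc; have B0 : 0 < beta_fun s.+1 m.+1 :> R := beta_fun_gt0 _ _.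
rewrite -lee_fin fineK ?beta_prob_fin_num // -integral_beta_pdf //.
have cB0 : 0 <= c / beta_fun s.+1 m.+1 by rewrite divr_ge0 // ltW.
apply: (@le_trans _ _ (\int[mu]_(x in U)
    ((c / beta_fun s.+1 m.+1)%:E * (\1_(`[0, 1]%classic) x)%:E))%E).
  apply: ge0_le_integral => //.
  - by move=> x _; rewrite lee_fin beta_pdf_ge0.
  - by apply/measurable_EFinP/measurable_funTS; exact: measurable_beta_pdf.
  - apply/measurable_funTS; apply: measurable_funeM.
    by apply/measurable_EFinP; exact: measurable_indic.
  move=> x Ux; rewrite -EFinM lee_fin /beta_pdf patchE indicE.
  case: ifPn => [xin|_]; last by rewrite mul0r mulr0.
  rewrite mulr1 ler_wpM2r ?invr_ge0 ?(ltW B0) //; apply: hc => //.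
  by move: xin; rewrite inE /= in_itv.
rewrite ge0_integralZl //.
- rewrite integral_indic //.
  rewrite -[leRHS]mule1; apply: lee_pmul => //.
  apply: (@le_trans _ _ (mu `[0%R, 1%R]%classic)).
    by apply: le_measure; rewrite ?inE //; exact: measurableI.
  by rewrite lebesgue_measure_itv /= lte_fin ltr01 oppr0 adde0.
- by apply/measurable_EFinP/measurable_funTS; exact: measurable_indic.
Qed.

Lemma beta_prob_ge s m c u v (U : set (measurableTypeR R)) : measurable U ->
  0 <= u -> u < v -> v <= 1 -> `]u, v[%classic `<=` U -> 0 <= c ->
  (forall x, u < x < v -> c <= XMonemX s m x) ->
  c * (v - u) / beta_fun s.+1 m.+1 <= fine (beta_prob s.+1 m.+1 U).
Proof.
move=> mU u0 uv v1 uvU c0 hc; have B0 : 0 < beta_fun s.+1 m.+1 :> R := beta_fun_gt0 _ _.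
rewrite -lee_fin fineK ?beta_prob_fin_num // -integral_beta_pdf //.
apply: (@le_trans _ _ (\int[mu]_(x in `]u, v[%classic) (beta_pdf s.+1 m.+1 x)%:E)%E); last first.
  apply: ge0_subset_integral => //.
  - by apply/measurable_EFinP/measurable_funTS; exact: measurable_beta_pdf.
  - by move=> x _; rewrite lee_fin beta_pdf_ge0.
apply: (@le_trans _ _ (\int[mu]_(x in `]u, v[%classic) cst (c / beta_fun s.+1 m.+1)%:E x)%E).
  rewrite integral_cst //= lebesgue_measure_itv /= lte_fin uv -EFinD -EFinM lee_fin.
  by rewrite mulrAC.
apply: ge0_le_integral => //.
- by move=> x _; rewrite lee_fin divr_ge0 // ltW.
- by apply/measurable_EFinP/measurable_funTS; exact: measurable_beta_pdf.
move=> x /=; rewrite in_itv /= => /andP[ux xv].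
rewrite lee_fin /beta_pdf patchE mem_set /= ?in_itv /=; last by lra.
by rewrite ler_wpM2r ?invr_ge0 ?(ltW B0) //; apply: hc; rewrite ux.
Qed.

(** Left of the mode the density on [0, y] is largest at [y], where it equals [(s + m).+1] times the
    binomial weight. *)
Lemma beta_lower_tail s m y : 0 < y < 1 -> (s + m)%:R * y <= s%:R ->
  fine (beta_prob s.+1 m.+1 [set x | x <= y]) <=
  (s + m).+1%:R * binw y (s + m) s.
Proof.
move=> /andP[y0 y1] hy.
apply: le_trans (beta_prob_le (c := XMonemX s m y) _ _ _) _.
- by rewrite -set_itvNyc.
- by rewrite XMonemX_ge0 // in_itv /= !ltW.
- by move=> x /= xy /andP[x0 _]; exact: XMonemX_homo.
by rewrite beta_funV /binw addKn !XMonemXE le_eqVlt; apply/orP; left; apply/eqP; ring.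
Qed.

Lemma beta_upper_tail s m y : 0 < y < 1 -> s%:R <= (s + m)%:R * y ->
  fine (beta_prob s.+1 m.+1 [set x | y < x]) <=
  (s + m).+1%:R * binw y (s + m) s.
Proof.
move=> /andP[y0 y1] hy.
apply: le_trans (beta_prob_le (c := XMonemX s m y) _ _ _) _.
- by rewrite -set_itvoy.
- by rewrite XMonemX_ge0 // in_itv /= !ltW.
- move=> x /= xy /andP[x0 x1].
  (* The reflection x -> 1 - x exchanges the two tails. *)
  rewrite -(XMonemXC m s x) -(XMonemXC m s y); by apply: XMonemX_homo; lra.
by rewrite beta_funV /binw addKn !XMonemXE le_eqVlt; apply/orP; left; apply/eqP; ring.
Qed.

Lemma bernoulli_ineq (t : R) m : 0 <= t <= 1 -> 1 - m%:R * t <= (1 - t) ^+ m.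
Proof.
move=> /andP[t0 t1]; elim: m => [|m IH]; first by rewrite mul0r subr0 expr0.
rewrite exprS -natr1; have m0 : 0 <= m%:R :> R by [].
have := @ler_wpM2l _ (1 - t) _ _ _ IH; rewrite subr_ge0 => /(_ t1).
by apply: le_trans; nra.
Qed.

(** Integrate only over a window of length of order 1 / (n + 1) to the right of [y]: there the
    kernel is at least half its value at [y], and the width cancels the factor n + 1 of the
    normalization. *)
Lemma beta_upper_tail_ge s m y : 0 < y < 1 ->
  binw y (s + m) s * ((1 - y) / 4) <=
  fine (beta_prob s.+1 m.+1 [set x | y < x]).
Proof.
move=> /andP[y0 y1]; set n := (s + m)%N.
(* This width gives [m%:R * t <= 1 / 2], so that Bernoulli's inequality loses only a factor 2. *)
pose t : R := (2 * n.+1%:R)^-1.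
have n1 : 0 < n.+1%:R :> R by [].
have t0 : 0 < t by rewrite invr_gt0 mulr_gt0.
have tn : t * (2 * n.+1%:R) = 1 by rewrite mulVf // gt_eqF // mulr_gt0.
have t1 : t <= 1 / 2.
  have : 1 <= n.+1%:R :> R by rewrite ler1n.
  by nra.
have B : 1 / 2 <= (1 - t) ^+ m.
  apply: le_trans (_ : _ <= 1 - m%:R * t) _.
    have : m%:R <= n.+1%:R :> R by rewrite ler_nat /n leqW // leq_addl.
    by nra.
  by apply: bernoulli_ineq; rewrite (ltW t0); lra.
apply: le_trans (@beta_prob_ge s m (y ^+ s * ((1 - y) ^+ m / 2)) y (y + (1 - y) * t)
  _ _ _ _ _ _ _ _).
- rewrite beta_funV -/n /binw /n addKn -/n le_eqVlt; apply/orP; left; apply/eqP.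
  by rewrite /t; field; rewrite nat1r gt_eqF.
- by rewrite -set_itvoy.
- exact: ltW.
- by rewrite ltrDl mulr_gt0 // subr_gt0.
- by nra.
- by move=> x /=; rewrite in_itv /= => /andP[].
- by rewrite !mulr_ge0 ?exprn_ge0 ?subr_ge0 ?(ltW y0) ?(ltW y1).
move=> x /andP[yx xv]; rewrite !XMonemXE; apply: ler_pM.
- by rewrite exprn_ge0 // ltW.
- by rewrite mulr_ge0 ?exprn_ge0 ?subr_ge0 ?(ltW y1).
- by rewrite lerXn2r ?nnegrE ?ltW //; lra.
apply: (@le_trans _ _ (((1 - y) * (1 - t)) ^+ m)).
  by rewrite exprMn ler_wpM2l ?exprn_ge0 ?subr_ge0 ?(ltW y1) //; lra.
rewrite lerXn2r ?nnegrE ?mulr_ge0 ?subr_ge0 ?(ltW y1) //; try lra.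
nra.
Qed.

End beta_tails.

(** * The kl-UCB index *)

Section binomial_sums.
Context {R : realType}.
Implicit Types (q x y L : R).

Lemma sum_binw_lt_le q L (T : nat) : 0 <= L ->
  \sum_(n < T) \sum_(s < n.+1) (n%:R < L)%R%:R * binw q n s <= L + 1.
Proof.
move=> L0; apply: le_trans (sum_lt_le T L0).
by apply: ler_sum => n _; rewrite -mulr_sumr sum_binw mulr1.
Qed.

(** Each of the [n.+1] values of [s] costs at most exp (- n (x - q)^2); the strict inequality
    excludes [n = 0]. *)
Lemma sum_binw_above_le q x : 0 < q < 1 -> q < x -> exists2 C : R, 0 < C &
  forall T : nat, \sum_(n < T) \sum_(s < n.+1) (x * n%:R < s%:R)%R%:R * binw q n s <= C.
Proof.
move=> q01 qx; have r0 : 0 < (x - q) ^+ 2 by rewrite exprn_gt0 // subr_gt0.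
have [C C0 hC] := sum_poly_expR_le 1 r0; exists C => // T.
apply: le_trans (hC T); apply: ler_sum => n _.
rewrite expr1 -[n.+1 in leRHS]card_ord -sumr_const mulr_suml.
apply: ler_sum => s _; rewrite mul1r.
have sn : (s <= n)%N by rewrite -ltnS.
case: ltP => [xs|_]; last by rewrite mul0r expR_ge0.
rewrite mul1r; apply: binw_le_gap => //; first by rewrite subr_ge0 ltW.
have [n0|n0] := posnP n.
  have nR : n%:R = 0 :> R by rewrite n0.
  have sR : (val s)%:R = 0 :> R by apply/eqP; rewrite pnatr_eq0 -leqn0 -n0.
  by move: xs; rewrite nR sR mulr0 ltxx.
rewrite (le_trans _ (ler_norm _)) // lerD2r ltW //.
by rewrite ltr_pdivlMr ?ltr0n.
Qed.

(* Below y < q the likelihood under q is exponentially smaller than under y,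
   which saves the peeling argument. *)
Lemma sum_binw_below_le q y : 0 < y < 1 -> 0 < q < 1 -> y < q -> exists2 C : R, 0 < C &
  forall (T : nat) (F : R), \sum_(n < T) \sum_(s < n.+1)
    [&& (0 < n)%N, s%:R < y * n%:R & F < n%:R * bkl (s%:R / n%:R) y]%R%:R *
    binw q n s <= C * expR (- F).
Proof.
move=> y01 q01 yq; have r0 : 0 < (y - q) ^+ 2.
  by rewrite -sqrrN opprB exprn_gt0 // subr_gt0.
have [C C0 hC] := sum_poly_expR_le 1 r0; exists C => // T F.
apply: le_trans (_ : _ <= (\sum_(n < T) n.+1%:R ^+ 1 *
   expR (- (n%:R * (y - q) ^+ 2))) * expR (- F)) _; last first.
  by rewrite ler_wpM2r ?expR_ge0.
rewrite mulr_suml; apply: ler_sum => n _.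
rewrite expr1 -[n.+1 in leRHS]card_ord -sumr_const 2!mulr_suml.
apply: ler_sum => s _; rewrite mul1r.
have sn : (s <= n)%N by rewrite -ltnS.
case: and3P => [[n0 sy FB]|_]; last by rewrite mul0r mulr_ge0 ?expR_ge0.
(* The likelihood ratio supplies the decay in [n], and the remaining weight under [y] supplies
   [expR (- F)]. *)
rewrite mul1r (binw_tilt y01 q01 sn); apply: ler_pM; rewrite ?expR_ge0 ?binw_ge0 //.
- by case/andP: y01 => *; rewrite !ltW.
- rewrite ler_expR lerN2 ler_wpM2l //.
  apply: (@le_trans _ _ (tilt y y q)).
    by rewrite tilt_diag bkl_ge_sqr //; case/andP: y01 => *; rewrite !ltW.
  by apply: le_tilt => //; rewrite ?(ltW yq) // ler_pdivrMr ?ltr0n // ltW.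
apply: le_trans (binw_le_expR y01 sn) _.
by rewrite ler_expR lerN2 ltW.
Qed.

End binomial_sums.

(** * Monotonicity and range of the corruption map *)

Section corruption.
Context {R : realType}.
Variable eps : R.
Hypothesis eps0 : 0 < eps.
Implicit Types x y : R.

Definition slope : R := (expR eps - 1) / (expR eps + 1).

Lemma slope_gt0 : 0 < slope.
Proof.
have : 1 < expR eps by rewrite expR_gt1.
by move=> e1; rewrite divr_gt0 //; lra.
Qed.

Lemma corruptB x y : corrupt eps x - corrupt eps y = slope * (x - y).
Proof. by rewrite /corrupt /slope; ring. Qed.

Lemma ler_corrupt x y : (corrupt eps x <= corrupt eps y) = (x <= y).
Proof. by rewrite -subr_ge0 corruptB pmulr_rge0 ?slope_gt0 // subr_ge0. Qed.

Lemma corrupt_inv_le x y : (corrupt_inv eps x <= corrupt_inv eps y) = (x <= y).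
Proof. by rewrite -ler_corrupt !corrupt_invK. Qed.

Lemma corrupt_itv x : 0 <= x <= 1 -> 0 < corrupt eps x < 1.
Proof.
have e1 : 1 < expR eps by rewrite expR_gt1.
move=> /andP[x0 x1]; apply/andP; split.
  apply: (@lt_le_trans _ _ (corrupt eps 0)); last by rewrite ler_corrupt.
  by rewrite /corrupt mulr0 addr0 invr_gt0; lra.
apply: (@le_lt_trans _ _ (corrupt eps 1)); first by rewrite ler_corrupt.
have -> : corrupt eps 1 = expR eps / (1 + expR eps).
  by rewrite /corrupt; field; rewrite !gt_eqF //; lra.
by rewrite ltr_pdivrMr; lra.
Qed.

End corruption.

Section klucb.
Context {R : realType} {K : nat}.
Variables (eps : R) (f : nat -> R).
Hypotheses (eps0 : 0 < eps) (f0 : forall t, 0 <= f t).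
Implicit Types (o : seq ('I_K * bool)) (x y : R).

Lemma kl_diag x : 0 <= x <= 1 -> kl x x = 0%E.
Proof.
move=> /andP[x0 x1]; rewrite /kl /kl_term.
have ln_diag z : z != 0 -> z * ln (z / z) = 0 by move=> z0; rewrite divff // ln1 mulr0.
case: eqVneq => [e|?]; case: eqVneq => [e'|?]; rewrite ?ln_diag ?add0e ?adde0 //.
Qed.

Lemma klucb_index_ge o a y : 0 <= y <= 1 ->
    ((npull o a)%:R%:E * kl (emp_mean o a) y <= (f (size o))%:E)%E ->
  corrupt_inv eps y <= klucb_index eps f o a.
Proof.
move=> y01 hy; apply: ub_le_sup; last by rewrite /= corrupt_invK.
exists (corrupt_inv eps 1) => q /= [/andP[_ q1] _].
by rewrite -(ler_corrupt eps0) corrupt_invK.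
Qed.

Lemma emp_mean_itv o a : (nsuccess o a <= npull o a)%N ->
  0 <= (emp_mean o a : R) <= 1.
Proof. exact: frac_itv. Qed.

(** A candidate with feedback mean above [y] is at distance at least [y - x] from the empirical
    mean, so by Pinsker its divergence exceeds the exploration budget. *)
Lemma klucb_index_le o a y x : (nsuccess o a <= npull o a)%N ->
    emp_mean o a <= x -> x <= y ->
    f (size o) < (npull o a)%:R * (y - x) ^+ 2 ->
  klucb_index eps f o a <= corrupt_inv eps y.
Proof.
move=> so mx xy fN; have m01 := emp_mean_itv so.
apply: ge_sup.
  (* The empirical mean is always admissible, so the supremum is over a nonempty set and not a
     default value. *)
  exists (corrupt_inv eps (emp_mean o a)) => /=; rewrite corrupt_invK //; split=> //.
  by rewrite kl_diag // mule0 lee_fin.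
move=> q /= [q01 hq]; rewrite -(ler_corrupt eps0) corrupt_invK // leNgt.
apply/negP => yq; move: fN; apply/negP; rewrite -leNgt -lee_fin.
apply: le_trans hq; rewrite EFinM lee_pmul ?lee_fin ?sqr_ge0 //.
apply: le_trans (kl_ge_sqr m01 q01); rewrite lee_fin -[leRHS]sqrrN opprB.
by rewrite lerXn2r ?nnegrE ?subr_ge0 //; lra.
Qed.

End klucb.

Lemma ln_nat_ge0 {R : realType} (T : nat) : 0 <= ln T%:R :> R.
Proof.
case: T => [|T]; first by rewrite ln0.
by rewrite ln_ge0 // ler1n.
Qed.

(** * Expected pulls of a suboptimal arm under kl-UCB-CF *)

Section klucb_pulls.
Context {R : realType} {K : nat}.
Variables (eps : R) (mu : 'I_K -> R) (best a : 'I_K).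
Hypotheses (eps0 : 0 < eps) (mu01 : forall b, 0 <= mu b <= 1).
Hypothesis best_gt : mu a < mu best.
Local Notation round := ('I_K * bool * bool)%type.
Local Notation lam b := (corrupt eps (mu b)).
Local Notation gap := (lam best - lam a).

Lemma lam_itv b : 0 < lam b < 1. Proof. exact: corrupt_itv. Qed.

Lemma gap_gt0 : 0 < gap.
Proof. by rewrite corruptB mulr_gt0 ?slope_gt0 // subr_gt0. Qed.

Lemma law_pulls_le_T T p q : history_law eps mu T p q ->
  \sum_(t < T) \sum_(h <- hists t) q h a <= T%:R.
Proof.
move=> pq; rewrite -[leRHS]mulr1 -[T in leRHS]card_ord mulr_natl -sumr_const.
apply: ler_sum => t _; rewrite -(law_total pq a (ltnW (ltn_ord t))).
by apply: ler_sum => h _; exact: law_arm_le pq _ _.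
Qed.

(** If [a] has many pulls and no overestimate, its index is at most that of level [y' < y]. The
    index of [best] is then below level [y], which forces an underestimate incompatible with [y] at
    budget [f]. *)
Lemma klucb_rule_cases (f : nat -> R) (h : seq round) (x y y' N0 : R) :
    (forall t, 0 <= f t) -> 1 <= N0 -> 0 < x -> x < y' -> y' < y -> y < 1 ->
    f (size h) < N0 * (y' - x) ^+ 2 ->
    klucb_rule eps f (observed h) a ->
  [|| (pulls h a)%:R < N0, x * (pulls h a)%:R < (succs h a)%:R |
    [&& (0 < pulls h best)%N, (succs h best)%:R < y * (pulls h best)%:R &
       f (size h) < (pulls h best)%:R *
         bkl ((succs h best)%:R / (pulls h best)%:R) y]].
Proof.
move=> f0 N1 x0 xy' y'y y1 fN rule.
have [//|N0a] /= := ltP (pulls h a)%:R N0.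
have [//|Sa] /= := ltP (x * (pulls h a)%:R) (succs h a)%:R.
have Na0 : 0 < (pulls h a)%:R :> R by lra.
have so : size (observed h) = size h by rewrite size_map.
move: rule; rewrite /klucb_rule so; case: ifP => [_ Na|_ /(_ best) ib].
  by rewrite /pulls Na ltxx in Na0.
have ia : klucb_index eps f (observed h) a <= corrupt_inv eps y'.
  apply: (@klucb_index_le _ _ _ _ eps0 f0 _ _ _ x) => //.
  - exact: succs_le_pulls.
  - by rewrite ler_pdivrMr.
  - exact: ltW.
  by rewrite so (lt_le_trans fN) // ler_wpM2r ?sqr_ge0.
have ib_lt : klucb_index eps f (observed h) best < corrupt_inv eps y.
  by rewrite (le_lt_trans ib) // (le_lt_trans ia) // ltNge corrupt_inv_le // -ltNge.
have y01 : 0 <= y <= 1 by lra.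
have [N0b|N0b] := posnP (pulls h best).
  suff : corrupt_inv eps y <= klucb_index eps f (observed h) best by rewrite leNgt ib_lt.
  by apply: klucb_index_ge => //; rewrite -/(pulls h best) N0b mul0e lee_fin.
(* An empirical mean of [best] at least [y] is itself admissible and would put the index at level
   [y] or above. *)
have [sb|sb] /= := ltP (succs h best)%:R (y * (pulls h best)%:R); last first.
  have mi : 0 <= (emp_mean (observed h) best : R) <= 1.
    by apply: emp_mean_itv; exact: succs_le_pulls.
  have : corrupt_inv eps (emp_mean (observed h) best) <=
      klucb_index eps f (observed h) best.
    by apply: klucb_index_ge => //; rewrite kl_diag // mule0 lee_fin.
  move=> /le_lt_trans /(_ ib_lt); rewrite ltNge corrupt_inv_le //.
  by rewrite ler_pdivlMr ?ltr0n // sb.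
rewrite ltNge; apply/negP => bad.
suff : corrupt_inv eps y <= klucb_index eps f (observed h) best by rewrite leNgt ib_lt.
apply: klucb_index_ge => //; rewrite kl_bkl; last by lra.
by rewrite -EFinM lee_fin so.
Qed.

Lemma klucb_pulls_le : exists C, forall (T : nat) (f : nat -> R) p q,
  klucb_exploration f -> history_law eps mu T p q ->
  (forall h, (size h < T)%N -> q h a != 0 -> klucb_rule eps f (observed h) a) ->
  \sum_(t < T) \sum_(h <- hists t) q h a <= 2 * ln T%:R / gap ^+ 2 + C.
Proof.
have D0 := gap_gt0; set D := gap in D0 *; have DE : D = gap by [].
have /andP[la0 la1] := lam_itv a; have /andP[lb0 lb1] := lam_itv best.
(* With these margins [y' - x] is 13/16 of the gap, and 2 (13/16)^2 = 338/256 exceeds the 1.31 of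
   [ln_lnln_lt]. *)
pose x := lam a + D / 16; pose y := lam best - D / 16; pose y' := lam best - D / 8.
have y01 : 0 < y < 1 by rewrite /y; lra.
have ax : lam a < x by rewrite ltrDl divr_gt0.
have yb : y < lam best by rewrite gtrBl divr_gt0.
have x0 : 0 < x by exact: lt_trans ax.
have xy' : x < y' by rewrite /x /y'; lra.
have y'y : y' < y by rewrite /y' /y; lra.
have y1 : y < 1 by exact: lt_trans lb1.
have [Ca Ca0 hCa] := sum_binw_above_le (lam_itv a) ax.
have [Cb Cb0 hCb] := sum_binw_below_le y01 (lam_itv best) yb.
exists (expR 400 + (2 + Ca + Cb * (3 + (ln 2)^-1 * (ln 2)^-1))) => T f p q hf pq rule.
have [_ f0 fmono] := hf.
have lnT0 := @ln_nat_ge0 R T.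
have l20 : 0 <= (ln 2)^-1 * (ln 2)^-1 :> R by rewrite -expr2 sqr_ge0.
have lead0 : 0 <= 2 * ln T%:R / D ^+ 2.
  by apply: divr_ge0; [rewrite mulr_ge0|exact: sqr_ge0].
have CC : 0 <= Cb * (3 + (ln 2)^-1 * (ln 2)^-1) by rewrite mulr_ge0 ?addr_ge0 // ltW.
(* Below the horizon at which the logarithmic comparison starts, the trivial bound [T] goes into the
   constant. *)
have [Tsmall|Tbig] := ltP (T%:R : R) (expR 400).
  by apply: le_trans (law_pulls_le_T pq) _; lra.
set L := 2 * ln T%:R / D ^+ 2 in lead0 *.
have T3 : (3 <= T)%N.
  by rewrite -(ler_nat R); have := expR_ge1Dx (400 : R) => ?; lra.
have fT t : (t < T)%N -> f t < (L + 1) * (y' - x) ^+ 2.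
  move=> tT; apply: (@le_lt_trans _ _ (f T)); first by apply: fmono; exact: ltnW.
  have [fE _ _] := hf; rewrite fE //.
  apply: lt_trans (ln_lnln_lt Tbig) _.
  have -> : y' - x = 13 / 16 * D by rewrite /y' /x DE; field.
  have -> : (L + 1) * (13 / 16 * D) ^+ 2 =
     338 / 256 * ln T%:R + (13 / 16 * D) ^+ 2.
    by rewrite /L; field; rewrite gt_eqF.
  have : 0 < (13 / 16 * D) ^+ 2 by rewrite exprn_gt0 // mulr_gt0.
  by lra.
pose g1 (n s : nat) : R := (n%:R < L + 1)%R%:R.
pose g2 (n s : nat) : R := (x * n%:R < s%:R)%R%:R.
pose g3 (F : R) (n s : nat) : R :=
  [&& (0 < n)%N, s%:R < y * n%:R & F < n%:R * bkl (s%:R / n%:R) y]%R%:R.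
(* The first two events are counted along the pulls of [a]. The third has a threshold depending on
   the round, so it is charged at each fixed time to the counters of [best]. *)
have key : \sum_(t < T) \sum_(h <- hists t) q h a <=
   \sum_(t < T) mean_pull q t a g1 + \sum_(t < T) mean_pull q t a g2 +
   \sum_(t < T) mean_at p t best (g3 (f t)).
  rewrite -!big_split /=; apply: ler_sum => t _.
  rewrite /mean_pull /mean_at -!big_split /= big_seq [leRHS]big_seq; apply: ler_sum => h /size_hists ht.
  have hT : (size h < T)%N by rewrite ht.
  have q0 := law_arm_ge0 pq h a; have p0 := law_ge0 pq h.
  have [->|qn0] := eqVneq (q h a) 0; first by rewrite !mul0r !add0r mulr_ge0.
  have L1 : 1 <= L + 1 by lra.
  have := klucb_rule_cases f0 L1 x0 xy' y'y y1 (fT _ hT) (rule _ hT qn0).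
  rewrite -ht /g1 /g2 /g3; case/or3P => ->; rewrite !mulr1.
  - by rewrite -addrA lerDl addr_ge0 // mulr_ge0.
  - by rewrite addrAC lerDr addr_ge0 // mulr_ge0.
  apply: le_trans (law_arm_le pq h a) _.
  by rewrite lerDr addr_ge0 // mulr_ge0.
apply: le_trans key _.
have k1 : \sum_(t < T) mean_pull q t a g1 <= L + 1 + 1.
  apply: le_trans (sum_pulls_le pq lam_itv a (leqnn T) _) _ => //.
  by apply: sum_binw_lt_le; lra.
have k2 : \sum_(t < T) mean_pull q t a g2 <= Ca.
  by apply: le_trans (sum_pulls_le pq lam_itv a (leqnn T) _) (hCa T).
have k3 : \sum_(t < T) mean_at p t best (g3 (f t)) <= Cb * (3 + (ln 2)^-1 * (ln 2)^-1).
  apply: le_trans (_ : _ <= Cb * \sum_(t < T) expR (- f t)) _; last first.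
    by rewrite ler_wpM2l ?(ltW Cb0) // klucb_exploration_sum.
  rewrite mulr_sumr; apply: ler_sum => t _.
  apply: le_trans (law_visit_le pq lam_itv best (ltnW (ltn_ord t)) _) _ => //.
  exact: hCb.
have := expR_ge0 (400 : R); lra.
Qed.

End klucb_pulls.

(** * Thompson sampling *)

Section beta_odds.
Context {R : realType}.
Implicit Types (q x y : R) (n s : nat).

Definition beta_tail y n s : R := fine (beta_prob s.+1 (n - s).+1 [set x : R | y < x]).

Lemma measurable_gt y : measurable [set x : measurableTypeR R | y < x].
Proof. by rewrite -set_itvoy. Qed.

Lemma measurable_le y : measurable [set x : measurableTypeR R | x <= y].
Proof. by rewrite -set_itvNyc. Qed.

Lemma beta_prob_fineT (i j : nat) : fine (beta_prob i j [set: R]) = 1 :> R.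
Proof. by rewrite probability_setT. Qed.

Lemma beta_tailC y n s :
  fine (beta_prob s.+1 (n - s).+1 [set x : R | x <= y]) = 1 - beta_tail y n s.
Proof.
rewrite /beta_tail -(beta_prob_fineT s.+1 (n - s).+1).
have -> : [set: R] = [set x | x <= y] `|` [set x | y < x].
  by apply/seteqP; split=> x //= _; case: (leP x y); [left|right].
rewrite measureU ?fineD ?beta_prob_fin_num ?addrK //.
- exact: measurable_le.
- exact: measurable_gt.
- exact: measurable_le.
- exact: measurable_gt.
by apply/seteqP; split=> x //= [xy]; rewrite ltNge xy.
Qed.

Lemma beta_tail_ge0 y n s : 0 <= beta_tail y n s.
Proof. exact/fine_ge0/measure_ge0. Qed.

Lemma beta_tail_le1 y n s : beta_tail y n s <= 1.
Proof. by rewrite -subr_ge0 -beta_tailC; exact/fine_ge0/measure_ge0. Qed.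

Lemma beta_tail_ge y n s : 0 < y < 1 -> (s <= n)%N ->
  binw y n s * ((1 - y) / 4) <= beta_tail y n s.
Proof. by move=> y01 sn; have := beta_upper_tail_ge s (n - s) y01; rewrite subnKC. Qed.

Lemma beta_tail_le y n s : 0 < y < 1 -> (s <= n)%N -> s%:R <= n%:R * y ->
  beta_tail y n s <= n.+1%:R * binw y n s.
Proof.
by move=> y01 sn h; have := @beta_upper_tail _ s (n - s) _ y01; rewrite subnKC //; apply.
Qed.

Lemma beta_tail_onem_le y n s : 0 < y < 1 -> (s <= n)%N -> n%:R * y <= s%:R ->
  1 - beta_tail y n s <= n.+1%:R * binw y n s.
Proof.
move=> y01 sn h; have := @beta_lower_tail _ s (n - s) _ y01.
by rewrite subnKC // beta_tailC; apply.
Qed.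

(** Crude bound uniform in [s], used where only finitely many [n] matter. *)
Lemma binw_ge_expn y n s : 0 < y < 1 -> (s <= n)%N -> (y * (1 - y)) ^+ n <= binw y n s.
Proof.
move=> /andP[y0 y1] sn; rewrite -{1}(subnKC sn) exprD /binw.
have y1' : 0 <= 1 - y by lra.
have w0 : 0 <= y * (1 - y) by rewrite mulr_ge0 // ltW.
rewrite -[leLHS]mul1r; apply: ler_pM; rewrite ?mulr_ge0 ?exprn_ge0 //.
  by rewrite ler1n bin_gt0.
apply: ler_pM; rewrite ?exprn_ge0 // lerXn2r ?nnegrE ?(ltW y0) //; nra.
Qed.

Lemma beta_tail_gt0 y n s : 0 < y < 1 -> (s <= n)%N -> 0 < beta_tail y n s.
Proof.
move=> y01 sn; have /andP[y0 y1] := y01.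
apply: lt_le_trans (beta_tail_ge y01 sn).
rewrite mulr_gt0 ?divr_gt0 ?subr_gt0 //.
apply: lt_le_trans (binw_ge_expn y01 sn).
by rewrite exprn_gt0 // mulr_gt0 // subr_gt0.
Qed.

Definition odds_against y n s : R := (1 - beta_tail y n s) / beta_tail y n s.

Lemma odds_against_ge0 y n s : 0 <= odds_against y n s.
Proof. by rewrite divr_ge0 ?beta_tail_ge0 // subr_ge0 beta_tail_le1. Qed.

Lemma gap_binw_le y x n s : 0 < y < 1 -> 0 <= x -> (s <= n)%N ->
  y + x <= s%:R / n%:R -> binw y n s <= expR (- (n%:R * x ^+ 2)).
Proof.
move=> y01 x0 sn h; apply: binw_le_gap => //.
by rewrite (le_trans _ (ler_norm _)) //; lra.
Qed.

(** With an empirical mean above [y + x], the Beta law puts mass at least 1/2 above [y] once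
    [n >= N]; smaller [n] fall under the crude bound. *)
Lemma beta_tail_inv_bounded y x : 0 < y < 1 -> 0 < x ->
  exists2 M : R, 0 < M & forall n s, (s <= n)%N -> (y + x) * n%:R < s%:R ->
    (beta_tail y n s)^-1 <= M.
Proof.
move=> y01 x0; have /andP[y0 y1] := y01.
have r0 : 0 < x ^+ 2 / 2 by rewrite divr_gt0 // exprn_gt0.
have [C C0 hC] := poly_expR_bounded 1 r0.
(* For [n >= N] the exponential of n x^2 / 2 exceeds [2 * C], so half of the rate brings the lower
   tail under 1/2. *)
pose N := Num.bound (4 * C / x ^+ 2).
have hN : 4 * C / x ^+ 2 < N%:R.
  by apply: archi_boundP; rewrite divr_ge0 ?sqr_ge0 ?mulr_ge0 // ltW.
have w0 : 0 < y * (1 - y) by rewrite mulr_gt0 // subr_gt0.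
have w1 : y * (1 - y) <= 1 by nra.
pose m := (y * (1 - y)) ^+ N * ((1 - y) / 4).
have m0 : 0 < m by rewrite mulr_gt0 ?exprn_gt0 // divr_gt0 // subr_gt0.
exists (m^-1 + 2) => [|n s sn hs]; first by rewrite addr_gt0 // invr_gt0.
have U0 := beta_tail_gt0 y01 sn.
have [nN|Nn] := ltnP n N.
  apply: (@le_trans _ _ m^-1); last by rewrite lerDl.
  rewrite lef_pV2 ?posrE //; apply: le_trans (beta_tail_ge y01 sn).
  rewrite ler_wpM2r ?divr_ge0 ?subr_ge0 ?(ltW y1) //.
  apply: le_trans (binw_ge_expn y01 sn).
  by apply: ler_wiXn2l; [exact: ltW|exact: w1|exact: ltnW].
apply: (@le_trans _ _ 2); last by rewrite lerDr invr_ge0 ltW.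
rewrite -[leRHS]invrK lef_pV2 ?posrE //.
have n0 : 0 < n%:R :> R.
  by apply: lt_le_trans (lt_trans _ hN) _; rewrite ?ler_nat // divr_gt0 ?exprn_gt0 // mulr_gt0.
have hb : binw y n s <= expR (- (n%:R * x ^+ 2)).
  by apply: gap_binw_le => //; [exact: ltW|rewrite ler_pdivlMr // ltW].
have hy : n%:R * y <= s%:R.
  by apply: le_trans (ltW hs); rewrite mulrC ler_pM2r // lerDl ltW.
have := beta_tail_onem_le y01 sn hy.
suff : n.+1%:R * binw y n s <= 1 / 2 by lra.
apply: le_trans (_ : _ <= n.+1%:R * expR (- (n%:R * x ^+ 2))) _.
  by rewrite ler_wpM2l.
have -> : - (n%:R * x ^+ 2) = - (n%:R * (x ^+ 2 / 2)) + - (n%:R * (x ^+ 2 / 2)) by field.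
rewrite expRD mulrA.
apply: le_trans (_ : _ <= C * expR (- (n%:R * (x ^+ 2 / 2)))) _.
  by rewrite ler_wpM2r ?expR_ge0 // -(expr1 n.+1%:R).
rewrite expRN ler_pdivrMr ?expR_gt0 //.
have := expR_ge1Dx (n%:R * (x ^+ 2 / 2)).
have : 4 * C < n%:R * x ^+ 2.
  rewrite -ltr_pdivrMr ?exprn_gt0 //.
  by apply: lt_le_trans hN _; rewrite ler_nat.
by lra.
Qed.

(** Split at empirical mean [y + x]. Below it, the odds are at most a multiple of the inverse weight
    under [y], which the change of parameter from [q] to [y] cancels. Above it, the inverse tail is
    bounded and the lower tail decays. *)
Lemma sum_odds_le q y : 0 < y < 1 -> 0 < q < 1 -> y < q ->
  exists2 C : R, 0 < C & forall T : nat,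
    \sum_(n < T) \sum_(s < n.+1) odds_against y n s * binw q n s <= C.
Proof.
move=> y01 q01 yq; have /andP[y0 y1] := y01; have /andP[q0 q1] := q01.
have l1 : ln (y / q) < 0 by rewrite ln_lt0 // divr_gt0 //= ltr_pdivrMr // mul1r.
have l2 : 0 < ln ((1 - y) / (1 - q)).
  by rewrite ln_gt0 // ltr_pdivlMr ?subr_gt0 // mul1r; lra.
have b0 : 0 < bkl y q.
  apply: (@lt_le_trans _ _ ((y - q) ^+ 2)).
    by rewrite -sqrrN opprB exprn_gt0 // subr_gt0.
  by rewrite bkl_ge_sqr // !ltW.
(* The affine function [tilt] has lost exactly half of its value at [y] when the empirical mean
   reaches [y + x]. *)
pose x := bkl y q / (2 * (ln ((1 - y) / (1 - q)) - ln (y / q))).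
have x0 : 0 < x by rewrite divr_gt0 // mulr_gt0 // subr_gt0; lra.
have tz : tilt (y + x) y q = bkl y q / 2.
  rewrite -[X in _ = X / 2]tilt_diag.
  have : x * (ln ((1 - y) / (1 - q)) - ln (y / q)) = bkl y q / 2.
    by rewrite /x; field; rewrite subr_eq0 gt_eqF //; lra.
  by rewrite -tilt_diag /tilt; lra.
have r0 : 0 < bkl y q / 2 by rewrite divr_gt0.
have [C C0 hC] := sum_poly_expR_le 1 r0.
have [M M0 hM] := beta_tail_inv_bounded y01 x0.
have x20 : 0 < x ^+ 2 by rewrite exprn_gt0.
have [C' C'0 hC'] := sum_poly_expR_le 2 x20.
have c40 : 0 < 4 / (1 - y) by rewrite divr_gt0 // subr_gt0.
exists (4 / (1 - y) * C + M * C') => [|T]; first by rewrite addr_gt0 // mulr_gt0.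
apply: le_trans (_ : _ <= 4 / (1 - y) * (\sum_(n < T) n.+1%:R ^+ 1 * expR (- (n%:R * (bkl y q / 2))))
  + M * (\sum_(n < T) n.+1%:R ^+ 2 * expR (- (n%:R * x ^+ 2)))) _; last first.
  by rewrite lerD // ler_wpM2l // ltW.
rewrite !mulr_sumr -big_split /=; apply: ler_sum => n _.
have -> : 4 / (1 - y) * (n.+1%:R ^+ 1 * expR (- (n%:R * (bkl y q / 2)))) +
    M * (n.+1%:R ^+ 2 * expR (- (n%:R * x ^+ 2))) =
    \sum_(s < n.+1) (4 / (1 - y) * expR (- (n%:R * (bkl y q / 2))) +
      M * (n.+1%:R * expR (- (n%:R * x ^+ 2)))).
  by rewrite sumr_const card_ord -[in RHS]mulr_natl; ring.
apply: ler_sum => s _; have sn : (s <= n)%N by rewrite -ltnS.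
have U0 := beta_tail_gt0 y01 sn; have U1 := beta_tail_le1 y n s.
have [hs|hs] := leP (s%:R : R) ((y + x) * n%:R).
  apply: (@le_trans _ _ (4 / (1 - y) * expR (- (n%:R * (bkl y q / 2))))); last first.
    by rewrite lerDl !mulr_ge0 ?expR_ge0 // ltW.
  rewrite (binw_tilt y01 q01 sn) mulrCA [leRHS]mulrC; apply: ler_pM.
  - exact: expR_ge0.
  - by rewrite mulr_ge0 ?odds_against_ge0 // binw_ge0 // !ltW.
  - rewrite ler_expR lerN2 ler_wpM2l // -tz.
    apply: le_tilt => //; first exact: ltW.
    have [n0|n0] := posnP n.
      have -> : n%:R = 0 :> R by rewrite n0.
      by rewrite invr0 mulr0; lra.
    by rewrite ler_pdivrMr ?ltr0n.
  rewrite /odds_against mulrAC ler_pdivrMr //.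
  have tg := beta_tail_ge y01 sn.
  have b1 : 0 <= binw y n s by rewrite binw_ge0 // !ltW.
  apply: (@le_trans _ _ (binw y n s)); first by rewrite ler_piMl // lerBlDr lerDl ltW.
  apply: (@le_trans _ _ (4 / (1 - y) * (binw y n s * ((1 - y) / 4)))); last first.
    by rewrite ler_pM2l.
  by rewrite le_eqVlt; apply/orP; left; apply/eqP; field; rewrite gt_eqF // subr_gt0.
apply: (@le_trans _ _ (M * (n.+1%:R * expR (- (n%:R * x ^+ 2))))); last first.
  by rewrite lerDr mulr_ge0 ?expR_ge0 // ltW.
have n0 : (0 < n)%N.
  rewrite lt0n; apply/eqP => n0.
  have nR : n%:R = 0 :> R by rewrite n0.
  have sR : (val s)%:R = 0 :> R by apply/eqP; rewrite pnatr_eq0 -leqn0 -n0.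
  by move: hs; rewrite nR sR mulr0 ltxx.
have n0R : 0 < n%:R :> R by rewrite ltr0n.
apply: (@le_trans _ _ (odds_against y n s)).
  by rewrite ler_piMr ?odds_against_ge0 // binw_le1 // !ltW.
rewrite /odds_against mulrC; apply: ler_pM.
- by rewrite invr_ge0 ltW.
- by rewrite subr_ge0.
- exact: hM.
apply: le_trans (beta_tail_onem_le y01 sn _) _.
  by apply: le_trans (ltW hs); rewrite mulrC ler_pM2r // lerDl ltW.
rewrite ler_wpM2l //; apply: gap_binw_le => //; first exact: ltW.
by rewrite ler_pdivlMr // ltW.
Qed.

End beta_odds.

(** * Expected pulls of a suboptimal arm under TS-CF *)

Section ts_pulls.
Context {R : realType} {K : nat}.
Variables (eps : R) (mu : 'I_K -> R) (best a : 'I_K).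
Hypotheses (eps0 : 0 < eps) (mu01 : forall b, 0 <= mu b <= 1).
Hypothesis best_gt : mu a < mu best.
Local Notation round := ('I_K * bool * bool)%type.
Local Notation lam b := (corrupt eps (mu b)).
Local Notation gap := (lam best - lam a).

Lemma ts_pulls_le : exists C, forall (T : nat) p q,
  history_law eps mu T p q ->
  (forall h y, (size h < T)%N -> 0 < y < 1 ->
     q h a <= p h * beta_tail y (pulls h a) (succs h a) +
       q h best * odds_against y (pulls h best) (succs h best)) ->
  \sum_(t < T) \sum_(h <- hists t) q h a <= 2 * ln T%:R / gap ^+ 2 + C.
Proof.
have D0 := gap_gt0 eps0 best_gt; set D := gap in D0 *; have DE : D = gap by [].
have lami := lam_itv eps0 mu01.
have /andP[la0 la1] := lami a; have /andP[lb0 lb1] := lami best.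
pose x := lam a + D / 16; pose y := lam best - D / 16.
have y01 : 0 < y < 1 by rewrite /y; lra.
have ax : lam a < x by rewrite ltrDl divr_gt0.
have yb : y < lam best by rewrite gtrBl divr_gt0.
have x0 : 0 < x by exact: lt_trans ax.
have xy : x < y by rewrite /x /y; lra.
have yxE : y - x = 7 / 8 * D by rewrite /x /y DE; field.
have [Ca Ca0 hCa] := sum_binw_above_le (lami a) ax.
have [Cb Cb0 hCb] := sum_odds_le y01 (lami best) yb.
have r0 : 0 < (y - x) ^+ 2 / 4 by rewrite divr_gt0 // exprn_gt0 // subr_gt0.
have [C C0 hC] := poly_expR_bounded 1 r0.
exists (1 + Ca + C + Cb) => T p q pq dom.
have lnT0 := @ln_nat_ge0 R T.
have lead0 : 0 <= 2 * ln T%:R / D ^+ 2.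
  by apply: divr_ge0; [rewrite mulr_ge0|exact: sqr_ge0].
set L := 2 * ln T%:R / D ^+ 2 in lead0 *.
have [T0|T0] := posnP T.
  rewrite big1 => [|[m mT] _]; first by lra.
  by exfalso; move: mT; rewrite T0.
have T0' : 0 < T%:R :> R by rewrite ltr0n.
have tail n s : (s <= n)%N -> L <= n%:R -> s%:R <= x * n%:R ->
    beta_tail y n s <= C / T%:R.
  move=> sn Ln sx.
  have sxn : s%:R / n%:R <= x.
    have [n0|n0] := posnP n; first by rewrite n0 invr0 mulr0 ltW.
    by rewrite ler_pdivrMr // ltr0n.
  apply: le_trans (beta_tail_le y01 sn _) _.
    by apply: le_trans sx _; rewrite mulrC ler_wpM2l // ltW.
  apply: le_trans (_ : _ <= n.+1%:R * expR (- (n%:R * (y - x) ^+ 2))) _.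
    rewrite ler_wpM2l // binw_le_gap // ?subr_ge0 ?(ltW xy) //.
    by rewrite distrC (le_trans _ (ler_norm _)) //; lra.
  have -> : - (n%:R * (y - x) ^+ 2) =
      (* A quarter of the rate absorbs the factor [n.+1]. For [n >= L] the other three quarters give
         3/4 * 49/32 > 1 times [ln T], hence a tail of order 1 / T per round. *)
      - (n%:R * ((y - x) ^+ 2 / 4)) + - (3 / 4 * (n%:R * (y - x) ^+ 2)) by field.
  rewrite expRD mulrA; apply: ler_pM; rewrite ?mulr_ge0 ?expR_ge0 //.
    by rewrite -(expr1 n.+1%:R).
  rewrite -[leRHS]lnK ?posrE ?invr_gt0 // ler_expR lnV ?posrE // lerN2.
  have : L * (y - x) ^+ 2 <= n%:R * (y - x) ^+ 2 by rewrite ler_wpM2r ?sqr_ge0.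
  have -> : L * (y - x) ^+ 2 = 49 / 32 * ln T%:R.
    by rewrite yxE /L; field; rewrite gt_eqF.
  by move=> ?; lra.
pose g1 (n s : nat) : R := (n%:R < L)%R%:R.
pose g2 (n s : nat) : R := (x * n%:R < s%:R)%R%:R.
have key : \sum_(t < T) \sum_(h <- hists t) q h a <=
   \sum_(t < T) mean_pull q t a g1 + \sum_(t < T) mean_pull q t a g2 +
   \sum_(t < T) \sum_(h <- hists t) p h * (C / T%:R) +
   \sum_(t < T) mean_pull q t best (odds_against y).
  rewrite -!big_split /=; apply: ler_sum => t _.
  rewrite /mean_pull -!big_split /= big_seq [leRHS]big_seq; apply: ler_sum => h /size_hists ht.
  have hT : (size h < T)%N by rewrite ht.
  have q0 := law_arm_ge0 pq h a; have qb0 := law_arm_ge0 pq h best.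
  have p0 := law_ge0 pq h.
  have o0 := odds_against_ge0 y (pulls h best) (succs h best).
  have qo0 := mulr_ge0 qb0 o0.
  have pc0 : 0 <= p h * (C / T%:R) by rewrite mulr_ge0 // divr_ge0 // ltW.
  rewrite /g1 /g2; case: ltP => [_|LN]; case: ltP => [_|xS]; rewrite ?mulr1 ?mulr0; try lra.
  apply: le_trans (dom h y hT y01) _; rewrite !add0r lerD2r ler_wpM2l //.
  by apply: tail => //; exact: succs_le_pulls.
apply: le_trans key _.
have k1 : \sum_(t < T) mean_pull q t a g1 <= L + 1.
  apply: le_trans (sum_pulls_le pq lami a (leqnn T) _) _ => //.
  exact: sum_binw_lt_le.
have k2 : \sum_(t < T) mean_pull q t a g2 <= Ca.
  by apply: le_trans (sum_pulls_le pq lami a (leqnn T) _) (hCa T).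
have k3 : \sum_(t < T) \sum_(h <- hists t) p h * (C / T%:R) <= C.
  rewrite (eq_bigr (fun=> C / T%:R)).
    by rewrite sumr_const card_ord -[leLHS]mulr_natr divfK // gt_eqF.
  by move=> t _; rewrite -mulr_suml (law_total pq a) ?mul1r // ltnW.
have k4 : \sum_(t < T) mean_pull q t best (odds_against y) <= Cb.
  apply: le_trans (sum_pulls_le pq lami best (leqnn T) _) (hCb T) => n s.
  exact: odds_against_ge0.
lra.
Qed.

End ts_pulls.

(** * Exchange of the sample of the optimal arm *)

Section ts_run.
Context {R : realType} {K : nat} {d : measure_display} {Omega : measurableType d}.
Variables (P : probability Omega R) (eps : R) (mu : 'I_K -> R) (T : nat).
Variables (arm : nat -> Omega -> 'I_K) (reward feedback : nat -> {RV P >-> bool}).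
Variable theta : nat -> 'I_K -> {RV P >-> R}.
Hypotheses (eps0 : 0 < eps) (run : ts_cf_run arm reward feedback eps mu theta T).
Local Notation round := ('I_K * bool * bool)%type.
Local Notation hist t w := (history arm reward feedback t w).
Local Notation p := (hist_prob arm reward feedback).
Local Notation q := (pull_prob arm reward feedback).
Local Notation tail y h b := (beta_tail y (pulls h b) (succs h b)).

Lemma nfailE (h : seq round) (b : 'I_K) : nfail (observed h) b = (pulls h b - succs h b)%N.
Proof.
apply/eqP; rewrite -(eqn_add2l (succs h b)) subnKC ?succs_le_pulls //.
rewrite /pulls /succs /npull /nsuccess /nfail; elim: (observed h) => [|[c f] o] //=.
move=> /eqP <-; rewrite !xpair_eqE; apply/eqP.
by case: (c == b); case: f => /=; lia.
Qed.

Lemma theta_prob (h : seq round) (B : 'I_K -> set R) : (size h < T)%N ->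
    (forall b, measurable (B b)) ->
  fine (P [set w | hist (size h) w = h /\ forall b, B b (theta (size h) b w)]) =
  p h * \prod_b fine (beta_prob (succs h b).+1 (pulls h b - succs h b).+1 (B b)).
Proof.
case: run => brun law _ hT mB; rewrite law // fineM //.
  by congr (_ * _) => /=; apply: eq_bigr => b _; rewrite nfailE.
by apply: prob_fin_num; exact: (measurable_history brun).
Qed.

Lemma measurable_hist_theta (h : seq round) (B : 'I_K -> set R) :
  (forall b, measurable (B b)) ->
  measurable [set w | hist (size h) w = h /\ forall b, B b (theta (size h) b w)].
Proof.
case: run => brun _ _ mB; apply: measurableI; first exact: (measurable_history brun).
have -> : (fun w => forall b, B b (theta (size h) b w)) =
    \bigcap_(b in [set: 'I_K]) (theta (size h) b @^-1` B b).
  by apply/seteqP; split=> w hw b; [move=> _; exact: hw|exact: hw].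
apply: fin_bigcap_measurable => // b _.
exact: (@measurable_funPTI _ _ _ _ (theta (size h) b) (B b)).
Qed.

(* If [theta_a <= y], no sample exceeds y; replacing the event [theta_best <= y]
   by [theta_best > y] makes [best] the pulled arm and multiplies the
   probability by the odds. *)
Lemma ts_domination (best a : 'I_K) (h : seq round) (y : R) : a != best ->
    (size h < T)%N -> 0 < y < 1 ->
  q h a <= p h * tail y h a + q h best * odds_against y (pulls h best) (succs h best).
Proof.
move=> ab hT y01; case: run => brun law rule.
pose Ba b := if b == a then [set x : R | y < x] else setT.
pose Bl (b : 'I_K) := [set x : R | x <= y].
pose Bb b := if b == best then [set x : R | y < x] else [set x : R | x <= y].
have mBa b : measurable (Ba b : set (measurableTypeR R)).
  by rewrite /Ba; case: ifP => _ //; exact: measurable_gt.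
have mBl b : measurable (Bl b : set (measurableTypeR R)) by exact: measurable_le.
have mBb b : measurable (Bb b : set (measurableTypeR R)).
  by rewrite /Bb; case: ifP => _; [exact: measurable_gt|exact: measurable_le].
pose ev B := [set w | hist (size h) w = h /\ forall b, B b (theta (size h) b w)].
have rule_le w b : hist (size h) w = h ->
    theta (size h) b w <= theta (size h) (arm (size h) w) w.
  by move=> _; have := rule _ w hT b; rewrite corrupt_inv_le.
have h1 : q h a <= fine (P (ev Ba)) + fine (P (ev Bl)).
  apply: le_trans (_ : _ <= fine (P (ev Ba `|` ev Bl))) _.
    apply: fine_prob_le.
    - exact: (measurable_pull brun).
    - by apply: measurableU; exact: measurable_hist_theta.
    move=> w /= [hw aw]; have [ya|ya] := ltP y (theta (size h) a w); [left|right];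
      split=> // b; rewrite /Ba /Bl /=.
      by case: eqP => // ->.
    by apply: le_trans ya; rewrite -[in leRHS]aw; exact: rule_le.
  rewrite -lee_fin EFinD !fineK ?prob_fin_num ?measureU2 //;
    try apply: measurableU; exact: measurable_hist_theta.
have h2 : fine (P (ev Bb)) <= q h best.
  apply: fine_prob_le.
  - exact: measurable_hist_theta.
  - exact: (measurable_pull brun).
  move=> w /= [hw hB]; split=> //; apply/eqP; rewrite -[_ == _]negbK; apply/negP => nb.
  have := hB (arm (size h) w); rewrite /Bb (negbTE nb) /= => le_y.
  have := hB best; rewrite /Bb eqxx /=; apply/negP; rewrite -leNgt.
  exact: le_trans (rule_le w best hw) le_y.
rewrite !theta_prob // in h1; rewrite theta_prob // in h2.
have ea : \prod_b fine (beta_prob (succs h b).+1 (pulls h b - succs h b).+1 (Ba b)) = tail y h a.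
  rewrite (bigD1 a) //= [X in _ * X]big1 ?mulr1; first by rewrite /Ba eqxx.
  by move=> b /negbTE ba; rewrite /Ba ba beta_prob_fineT.
(* The samples are independent, so both events share this factor over the other arms and their
   probabilities differ exactly by the odds. *)
pose rest := \prod_(b | b != best) (1 - tail y h b).
have el : \prod_b fine (beta_prob (succs h b).+1 (pulls h b - succs h b).+1 (Bl b)) =
    (1 - tail y h best) * rest.
  rewrite (eq_bigr (fun b => 1 - tail y h b)); first by rewrite (bigD1 best).
  by move=> b _; exact: beta_tailC.
have eb : \prod_b fine (beta_prob (succs h b).+1 (pulls h b - succs h b).+1 (Bb b)) =
    tail y h best * rest.
  rewrite (bigD1 best) //= {1}/Bb eqxx; congr (_ * _).
  by apply: eq_bigr => b /negbTE nb; rewrite /Bb nb beta_tailC.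
rewrite ea el in h1; rewrite eb in h2; apply: le_trans h1 _; rewrite lerD2l.
have U0 := beta_tail_gt0 y01 (succs_le_pulls h best).
have U1 := beta_tail_le1 y (pulls h best) (succs h best).
apply: le_trans (ler_wpM2r (odds_against_ge0 y _ _) h2).
rewrite /odds_against le_eqVlt; apply/orP; left; apply/eqP; field.
by rewrite gt_eqF.
Qed.

End ts_run.

(** * Regret *)

Section regret_bound.
Context {R : realType} {K : nat} {d : measure_display} {Omega : measurableType d}.
Variables (P : probability Omega R) (eps : R) (mu : 'I_K -> R) (T : nat).
Variables (arm : nat -> Omega -> 'I_K) (reward feedback : nat -> {RV P >-> bool}).
Hypotheses (eps0 : 0 < eps) (run : bandit_run arm reward feedback eps mu T).
Local Notation q := (pull_prob arm reward feedback).

(** The feedback gap is [slope eps] times the reward gap, so weighting the pulls by the reward gap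
    cancels one power of it. *)
Lemma regret_le (best : 'I_K) (C : 'I_K -> R) :
    (forall a, a != best -> mu a < mu best) ->
    (forall a, a != best -> \sum_(t < T) \sum_(h <- hists t) q h a <=
       2 * ln T%:R / (corrupt eps (mu best) - corrupt eps (mu a)) ^+ 2 + C a) ->
  (regret reward mu best T <=
    (\sum_(a < K | a != best) 2 * ln T%:R / ((mu best - mu a) * slope eps ^+ 2) +
     \sum_(a < K | a != best) (mu best - mu a) * C a)%:E)%E.
Proof.
move=> gt_best hC; rewrite (regret_pulls run) lee_fin (bigD1 best) //=.
rewrite subrr mul0r add0r -big_split /=; apply: ler_sum => a ab.
have D0 : 0 < mu best - mu a by rewrite subr_gt0 gt_best.
have s0 := slope_gt0 eps0.
apply: le_trans (ler_wpM2l (ltW D0) (hC a ab)) _.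
rewrite corruptB mulrDr lerD2r le_eqVlt; apply/orP; left; apply/eqP.
by field; rewrite !gt_eqF.
Qed.

(** Passes the pathwise selection rules to the pulls that carry mass in the history law. *)
Lemma pull_prob_neq0 h a : q h a != 0 ->
  exists w, history arm reward feedback (size h) w = h /\ arm (size h) w = a.
Proof.
apply: contra_neqP => /forallNP no; rewrite /pull_prob (_ : [set w | _] = set0) ?measure0 //.
by apply/seteqP; split=> w //; exact: no.
Qed.

End regret_bound.

Lemma cst_eqO_sqrt_ln (R : realType) (C : R) :
  (fun=> C : R) =O_\oo (fun T : nat => Num.sqrt (ln T%:R)).
Proof.
apply/eqOP; near=> k; near=> T.
have lnT : 1 <= ln (T%:R : R).
  rewrite -[leLHS]expRK ler_ln ?posrE ?expR_gt0 //.
    by near: T; exact: nbhs_infty_ger.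
  by near: T; exists 1%N => // n /=; rewrite ltr0n.
have s1 : 1 <= Num.sqrt (ln (T%:R : R)) by rewrite -[leLHS]sqrtr1; exact: ler_wsqrtr.
have kC : `|C| <= k by near: k; exact: nbhs_pinfty_ge.
rewrite (ger0_norm (sqrtr_ge0 _)); apply: (le_trans kC).
by rewrite -[leLHS]mulr1 ler_wpM2l // (le_trans (normr_ge0 C)).
Unshelve. all: by end_near. Qed.

Theorem corollary3 (R : realType) (K : nat) (hK : (2 <= K)%N) (eps : R)
    (heps : 0 < eps) (mu : 'I_K -> R) (arm1 : 'I_K)
    (harm1 : nat_of_ord arm1 = 0%N)
    (hmu : forall a, 0 <= mu a <= 1)
    (hopt : forall a, a != arm1 -> mu a < mu arm1) :
  (exists2 rem : nat -> R,
     rem =O_\oo (fun T => Num.sqrt (ln T%:R)) &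
     forall (T : nat) (d : measure_display) (Omega : measurableType d)
       (P : probability Omega R) (arm : nat -> Omega -> 'I_K)
       (reward feedback : nat -> {RV P >-> bool}) (f : nat -> R),
     klucb_exploration f ->
     klucb_cf_run arm reward feedback eps mu f T ->
     (regret reward mu arm1 T <=
      (\sum_(a < K | a != arm1)
         2 * ln T%:R /
         ((mu arm1 - mu a) * ((expR eps - 1) / (expR eps + 1)) ^+ 2)
       + rem T)%:E)%E) /\
  (exists2 rem : nat -> R,
     rem =O_\oo (fun T => Num.sqrt (ln T%:R)) &
     forall (T : nat) (d : measure_display) (Omega : measurableType d)
       (P : probability Omega R) (arm : nat -> Omega -> 'I_K)
       (reward feedback : nat -> {RV P >-> bool})
       (theta : nat -> 'I_K -> {RV P >-> R}),
     ts_cf_run arm reward feedback eps mu theta T ->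
     (regret reward mu arm1 T <=
      (\sum_(a < K | a != arm1)
         2 * ln T%:R /
         ((mu arm1 - mu a) * ((expR eps - 1) / (expR eps + 1)) ^+ 2)
       + rem T)%:E)%E).
Proof.
split.
(* Choice yields one constant per arm, fixed before the horizon, the probability space and the
   exploration function, so the remainder is uniform over all runs. *)
- have /choice[C hC] : forall a, exists C, a != arm1 ->
      forall (T : nat) (f : nat -> R) p q, klucb_exploration f ->
      history_law eps mu T p q ->
      (forall h, (size h < T)%N -> q h a != 0 -> klucb_rule eps f (observed h) a) ->
      \sum_(t < T) \sum_(h <- hists t) q h a <=
      2 * ln T%:R / (corrupt eps (mu arm1) - corrupt eps (mu a)) ^+ 2 + C.
    move=> a; have [->|a1] := eqVneq a arm1; first by exists 0.
    by have [C hC] := klucb_pulls_le heps hmu (hopt a a1); exists C.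
  exists (fun=> \sum_(a < K | a != arm1) (mu arm1 - mu a) * C a).
    exact: cst_eqO_sqrt_ln.
  move=> T d Omega P arm reward feedback f hf [run rule].
  apply: (regret_le heps run hopt) => a a1.
  apply: (hC a a1 T f _ _ hf (run_history_law run)) => h hT /pull_prob_neq0 [w [hw <-]].
  by rewrite -{1}hw; exact: rule.
have /choice[C hC] : forall a, exists C, a != arm1 ->
    forall (T : nat) p q, history_law eps mu T p q ->
    (forall h y, (size h < T)%N -> 0 < y < 1 ->
       q h a <= p h * beta_tail y (pulls h a) (succs h a) +
         q h arm1 * odds_against y (pulls h arm1) (succs h arm1)) ->
    \sum_(t < T) \sum_(h <- hists t) q h a <=
    2 * ln T%:R / (corrupt eps (mu arm1) - corrupt eps (mu a)) ^+ 2 + C.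
  move=> a; have [->|a1] := eqVneq a arm1; first by exists 0.
  by have [C hC] := ts_pulls_le heps hmu (hopt a a1); exists C.
exists (fun=> \sum_(a < K | a != arm1) (mu arm1 - mu a) * C a).
  exact: cst_eqO_sqrt_ln.
move=> T d Omega P arm reward feedback theta tsrun; have [run _ _] := tsrun.
apply: (regret_le heps run hopt) => a a1.
by apply: (hC a a1 T _ _ (run_history_law run)) => h y hT y01; exact: (ts_domination heps tsrun).
Qed.
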